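(* Let $\Gamma=(A_i,u_i)_{i=1,2}$ be a finite two-player game. For every curb set $B=B_1\times B_2$, the set $H_B=H\cap\Delta_B(A)$ is eventually attracting under every no-regret dynamics in class $\mathcal R$ (with (Q2) replaced by (Q2$'$), as in the definition of class $\mathcal R$ in the context).
   Context: **Game.** $A_i$ is the finite action set of player $i$, $A=A_1\times A_2$, $u_i:A\to\mathbb R$ is the payoff function, extended (multi)linearly to distributions; $-i$ denotes the opponent of $i$; $\Delta(S)$ is the set of probability distributions on a finite set $S$; pure actions are identified with vertices. For $z\in\Delta(A)$, $z_i\in\Delta(A_i)$ is its marginal for player $i$. $BR_i(x_{-i})=\{x_i\in\Delta(A_i): u_i(x_i,x_{-i})=\max_{k\in A_i}u_i(k,x_{-i})\}$. **Regret.** $R_{i,k}(z)=u_i(k,z_{-i})-u_i(z)$, $R_i(z)=(R_{i,k}(z))_{k\in A_i}$, $R_{i,\max}(z)=\max_{k\in A_i}R_{i,k}(z)$. The Hannan set is $H=\{z\in\Delta(A): R_{i,\max}(z)\le0,\ i=1,2\}$. **Curb sets.** For $B_i\subset A_i$, $\Delta(B_i)$ denotes the probability measures on $A_i$ with support in $B_i$. A product set $B=B_1\times B_2$ (with $B_1,B_2$ nonempty) is curb (closed under rational behavior) if $BR_i(x_{-i})\subset\Delta(B_i)$ whenever $x_{-i}\in\Delta(B_{-i})$, $i=1,2$. $\Delta_B(A)$ is the set of $z\in\Delta(A)$ with support in $B$. **Repeated play.** At each $t=1,2,\dots$ player $i$ chooses $a_i(t)\in A_i$; $a(t)=(a_1(t),a_2(t))$,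 $h(t)=(a(1),\dots,a(t))$. A strategy of player $i$ assigns to each history $h(t-1)$ a mixed action $q_i(t)\in\Delta(A_i)$, with weights $q_{i,k}(t)$; given $h(t-1)$, $a_1(t)$ and $a_2(t)$ are drawn independently from $q_1(t),q_2(t)$. $z(t)=\frac1t\sum_{\tau=1}^ta(\tau)\in\Delta(A)$; write $R_i(t)=R_i(z(t))$, $R_{i,\max}(t)=R_{i,\max}(z(t))$. **Potential.** A twice differentiable convex function $P_i:\mathbb R^{A_i}\to\mathbb R$ such that, with $\mathbb R_-^{A_i}$ the nonpositive orthant and $\nabla_k$ the partial derivative in coordinate $k$: (R1) $P_i\ge 0$ and $P_i(x)=0$ for all $x\in\mathbb R_-^{A_i}$; (R2) $\nabla P_i(\cdot)\ge 0$ and $\nabla P_i(x)\cdot x>0$ for all $x\notin\mathbb R_-^{A_i}$; (R3) if $x\notin\mathbb R_-^{A_i}$ and $x_k\le 0$, then $\nabla_kP_i(x)=0$. **Class $\mathcal R$ (as used here).** Processes $(z(t))_{t\ge1}$ generated when for each $i=1,2$ there is a potential $P_i$ satisfying (R1)–(R3) such that (Q1) whenever $R_{i,\max}(t)>0$: $q_{i,k}(t+1)=\nabla_kP_i(R_i(t))\big/\sum_{s\in A_i}\nabla_sP_i(R_i(t))$ for all $k\in A_i$; (Q2$'$) whenever $R_{i,\max}(t)\le0$, player $i$ plays at $t+1$ a best reply to the empirical distribution $z_{-i}(t)$ of her opponent. **Eventually attracting.** A set $\mathcal C\subset\Delta(A)$ is eventually attracting under such a process if for every $\pi>0$ there exist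 $\varepsilon>0$ and a period $T$ such that for every $t_0\ge T$: if $z(t_0)$ is in the $\varepsilon$-neighborhood of $\mathcal C$, then (conditionally on the history $h(t_0)$) with probability at least $1-\pi$, $z(t)$ converges to $\mathcal C$, i.e. $\inf_{c\in\mathcal C}\|z(t)-c\|\to0$ as $t\to\infty$. *)

(* Defs.v *)
From HB Require Import structures.
From mathcomp Require Import all_boot all_order all_algebra.
From mathcomp Require Import all_classical all_reals all_analysis.

Set Implicit Arguments.
Unset Strict Implicit.
Unset Printing Implicit Defensive.

Import Order.TTheory GRing.Theory Num.Theory.
Import numFieldNormedType.Exports.

Local Open Scope classical_set_scope.
Local Open Scope ring_scope.

(* For a finite type T, the space R^T is 'rV[R]_#|T|, so that the norm, the
   topology and the derivatives of the library apply; the coordinate at k : T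
   is the entry of index enum_rank k.  The norm is the sup norm. *)
Definition coord (R : realType) (T : finType) (x : 'rV[R]_#|T|) (k : T) : R :=
  x 0 (enum_rank k).

Definition vect (R : realType) (T : finType) (f : T -> R) : 'rV[R]_#|T| :=
  \row_j f (enum_val j).

Definition vertex (R : realType) (T : finType) (k : T) : 'rV[R]_#|T| :=
  vect (fun l => (l == k)%:R).

(* T is nonempty wherever this is used, so the supremum is a maximum. *)
Definition maxf (R : realType) (T : finType) (f : T -> R) : R := sup (range f).

Definition simplex (R : realType) (T : finType) : set 'rV[R]_#|T| :=
  [set x | (forall k, 0 <= coord x k) /\ \sum_(k : T) coord x k = 1].

Definition face (R : realType) (T : finType) (B : {set T}) :
    set 'rV[R]_#|T| :=
  [set x | simplex x /\ forall k, k \notin B -> coord x k = 0].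

Definition marginal (R : realType) (S T : finType) (p : S -> T)
    (z : 'rV[R]_#|S|) : 'rV[R]_#|T| :=
  vect (fun k => \sum_(a : S | p a == k) coord z a).

Definition mixed_payoff (R : realType) (A B : finType) (u : A -> B -> R)
    (x : 'rV[R]_#|A|) (y : 'rV[R]_#|B|) : R :=
  \sum_(k : A) \sum_(l : B) coord x k * coord y l * u k l.

Definition joint_payoff (R : realType) (A1 A2 : finType) (u : A1 -> A2 -> R)
    (z : 'rV[R]_#|{: A1 * A2}|) : R :=
  \sum_(a : A1 * A2) coord z a * u a.1 a.2.

(* Best replies are stated for a payoff u : A -> B -> R whose first argument is
   the player's own action; player 2 uses them with (fun b a => u2 a b). *)
Definition best_reply (R : realType) (A B : finType) (u : A -> B -> R)
    (y : 'rV[R]_#|B|) : set 'rV[R]_#|A| :=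
  [set x | simplex x /\
    mixed_payoff u x y = maxf (fun k : A => mixed_payoff u (vertex R k) y)].

Definition regret1 (R : realType) (A1 A2 : finType) (u1 : A1 -> A2 -> R)
    (z : 'rV[R]_#|{: A1 * A2}|) : 'rV[R]_#|A1| :=
  vect (fun k => mixed_payoff u1 (vertex R k) (marginal snd z)
                 - joint_payoff u1 z).

Definition regret2 (R : realType) (A1 A2 : finType) (u2 : A1 -> A2 -> R)
    (z : 'rV[R]_#|{: A1 * A2}|) : 'rV[R]_#|A2| :=
  vect (fun k => mixed_payoff u2 (marginal fst z) (vertex R k)
                 - joint_payoff u2 z).

Definition hannan (R : realType) (A1 A2 : finType) (u1 u2 : A1 -> A2 -> R) :
    set 'rV[R]_#|{: A1 * A2}| :=
  [set z | [/\ simplex z, maxf (coord (regret1 u1 z)) <= 0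
             & maxf (coord (regret2 u2 z)) <= 0]].

Definition curb (R : realType) (A1 A2 : finType) (u1 u2 : A1 -> A2 -> R)
    (B1 : {set A1}) (B2 : {set A2}) : Prop :=
  [/\ B1 != finset.set0, B2 != finset.set0,
      forall y, face B2 y -> best_reply u1 y `<=` face B1
    & forall x, face B1 x -> best_reply (fun b a => u2 a b) x `<=` face B2].

Definition hannan_in (R : realType) (A1 A2 : finType)
    (u1 u2 : A1 -> A2 -> R) (B1 : {set A1}) (B2 : {set A2}) :
    set 'rV[R]_#|{: A1 * A2}| :=
  hannan u1 u2 `&` face (finset.setX B1 B2).

Definition grad (R : realType) (T : finType) (P : 'rV[R]_#|T| -> R)
    (x : 'rV[R]_#|T|) : 'rV[R]_#|T| :=
  vect (fun k => 'D_(vertex R k) P x).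

Definition nonpos_orthant (R : realType) (T : finType) : set 'rV[R]_#|T| :=
  [set x | forall k, coord x k <= 0].

(* Twice differentiability: P is differentiable everywhere, and so is its
   gradient; the second derivative need not be continuous. *)
Definition potential (R : realType) (T : finType) (P : 'rV[R]_#|T| -> R) :
    Prop :=
  (forall x, differentiable P x) /\
  (forall x, differentiable (grad P) x) /\
  convex_function setT P /\
  (forall x, 0 <= P x) /\
  (forall x, nonpos_orthant x -> P x = 0) /\
  (forall x k, 0 <= coord (grad P x) k) /\
  (forall x, ~ nonpos_orthant x ->
     0 < \sum_(k : T) coord (grad P x) k * coord x k) /\
  (forall x k, ~ nonpos_orthant x -> coord x k <= 0 ->
     coord (grad P x) k = 0).

(* A history h(t) = (a(1), ..., a(t)) is a sequence of length t, oldest action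
   profile first; z(t) is the empirical distribution of h(t). *)
Definition empirical (R : realType) (S : finType) (h : seq S) : 'rV[R]_#|S| :=
  (size h)%:R^-1 *: \sum_(a <- h) vertex R a.

(* The mixed action q_i(t+1) is q h for h = h(t). *)
Definition strategy (R : realType) (S A : finType)
    (q : seq S -> 'rV[R]_#|A|) : Prop :=
  forall h, simplex (q h).

(* One player's part of the class: reg maps z(t) to the regret vector of the
   player and opp maps z(t) to the marginal of the opponent.  The first period
   (empty history) is unconstrained. *)
Definition class_R_strategy (R : realType) (S A B : finType)
    (u : A -> B -> R) (reg : 'rV[R]_#|S| -> 'rV[R]_#|A|)
    (opp : 'rV[R]_#|S| -> 'rV[R]_#|B|) (q : seq S -> 'rV[R]_#|A|) : Prop :=
  exists2 P : 'rV[R]_#|A| -> R, potential P &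
    forall h : seq S, (0 < size h)%N ->
      let z := empirical R h in
      (0 < maxf (coord (reg z)) ->
         forall k, coord (q h) k =
           coord (grad P (reg z)) k / \sum_(s : A) coord (grad P (reg z)) s) /\
      (maxf (coord (reg z)) <= 0 -> best_reply u (opp z) (q h)).

(* Junk value 0 when P F = 0. *)
Definition cond_prob (R : realType) (d : measure_display)
    (Omega : measurableType d) (P : probability Omega R) (E F : set Omega) : R :=
  fine (P (E `&` F)) / fine (P F).

(* act t is the action profile a(t), for t >= 1; act 0 is not used. *)
Definition history (Omega : Type) (S : finType) (act : nat -> Omega -> S)
    (t : nat) (w : Omega) : seq S :=
  [seq act s w | s <- iota 1 t].

(* Given h(t), the components of a(t+1) are drawn independently from q1 h(t)
   and q2 h(t). *)
Definition play (R : realType) (A1 A2 : finType) (d : measure_display)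
    (Omega : measurableType d) (P : probability Omega R)
    (q1 : seq (A1 * A2) -> 'rV[R]_#|A1|) (q2 : seq (A1 * A2) -> 'rV[R]_#|A2|)
    (act : nat -> Omega -> A1 * A2) : Prop :=
  (forall t a, measurable [set w | act t.+1 w = a]) /\
  forall t (h : seq (A1 * A2)),
    (0 < P [set w | history act t w = h])%E ->
    forall (k : A1) (l : A2),
      cond_prob P [set w | act t.+1 w = (k, l)] [set w | history act t w = h]
      = coord (q1 h) k * coord (q2 h) l.

Definition class_R (R : realType) (A1 A2 : finType) (u1 u2 : A1 -> A2 -> R)
    (d : measure_display) (Omega : measurableType d) (P : probability Omega R)
    (act : nat -> Omega -> A1 * A2) : Prop :=
  exists (q1 : seq (A1 * A2) -> 'rV[R]_#|A1|)
         (q2 : seq (A1 * A2) -> 'rV[R]_#|A2|),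
    [/\ strategy q1, strategy q2,
        class_R_strategy u1 (regret1 u1) (marginal snd) q1,
        class_R_strategy (fun b a => u2 a b) (regret2 u2) (marginal fst) q2
      & play P q1 q2 act].

(* inf set0 = 0, but eventually_attracting only constrains nonempty C. *)
Definition set_dist (R : realType) (n : nat) (C : set 'rV[R]_n)
    (z : 'rV[R]_n) : R :=
  inf [set `|z - c| | c in C].

Definition eventually_attracting (R : realType) (S : finType)
    (d : measure_display) (Omega : measurableType d) (P : probability Omega R)
    (act : nat -> Omega -> S) (C : set 'rV[R]_#|S|) : Prop :=
  forall p : R, 0 < p ->
  exists2 eps : R, 0 < eps & exists T : nat,
  forall t0 : nat, (T <= t0)%N -> forall h : seq S,
    (0 < P [set w | history act t0 w = h])%E ->
    (exists2 c, C c & `|empirical R h - c| < eps) ->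
    1 - p <= cond_prob P
      [set w | set_dist C (empirical R (history act t w)) @[t --> \oo]
               --> (0 : R)]
      [set w | history act t0 w = h].

(* Main.v *)
From mathcomp Require Import all_boot all_order all_algebra.
From mathcomp Require Import all_classical all_reals all_analysis.
From mathcomp Require Import ring lra zify.
Require Import Defs.

Set Implicit Arguments.
Unset Strict Implicit.
Unset Printing Implicit Defensive.

Import Order.TTheory GRing.Theory Num.Theory.
Import numFieldNormedType.Exports.

Local Open Scope classical_set_scope.
Local Open Scope ring_scope.

(** Why the set is attracting.

    Write x(t) for the regret vector of one player, the mean of the pure
    regrets r(a(1)), ..., r(a(t)), and V(t) = P(x(t)).  Two tangent planes of
    the convex function P, at x(t + 1) evaluated at x(t) and at x(t) evaluated
    at 0, give
      (t + 1) V(t + 1) <= t V(t) + <grad P(x(t)), r(a(t + 1))> + o(1),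
    where the error is the variation of the gradient between x(t) and x(t + 1)
    and vanishes by uniform continuity on the compact set of regret vectors
    (potential_drift).  Given h(t), the middle term has mean zero, because play
    is proportional to the gradient (blackwell_condition).  Hence for small
    theta the exponential of theta t (V(t) - eta) contracts in mean by a factor
    rho < 1 at each step (exp_potential_contract).  Markov's inequality turns
    this into two facts (potential_concentration): V exceeds eta after
    n more periods with probability O(rho^n), so that V(t) tends to 0 almost
    surely; and if V(t0) <= eta / 2, the probability that V ever exceeds eta
    after t0 is at most the tail of a geometric series, which is small for
    large t0.  This holds wherever the play goes, so nothing has to be
    stopped when it leaves a neighborhood of the Hannan set.

    The rest is a statement about individual paths.  Let L be the mass that z
    puts outside B plus the potentials V1 and V2 of the two players.  On the
    simplex L >= 0, and L vanishes exactly on H_B.  At a point of H_B, every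
    action of maximal or nonnegative regret is a best reply to a mixed action
    supported in B, hence lies in B; by compactness this persists where L is
    small (curb_gap).  The process only uses actions of positive or of maximal
    regret (regret_action_support), so as long as L is small every action
    belongs to B, the mass outside B decreases like 1/t (mass_outside_path),
    and L stays small provided that V1 and V2 do.  Then L tends to 0, and by
    compactness again the distance to H_B tends to 0 (lyapunov_cvg). *)

(** * Continuous functions on compact sets *)

Lemma continuous_sum_fin (R : realType) (T : topologicalType)
    (V : normedModType R) (I : finType) (f : I -> T -> V) :
  (forall i, continuous (f i)) -> continuous (fun x => \sum_(i : I) f i x).
Proof.
move=> cf; elim: (index_enum I) => [|i s IH] x.
  by under eq_fun do rewrite big_nil; apply: cvg_cst.
under eq_fun do rewrite big_cons.
by apply: cvgD; [apply: cf | apply: IH].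
Qed.

Lemma continuous_scale (R : realType) (T : topologicalType)
    (V : normedModType R) (f : T -> R) (v : V) :
  continuous f -> continuous (fun x => f x *: v).
Proof. by move=> cf x; apply: cvgZr_tmp; exact: cf. Qed.

Lemma continuousD_fun (R : realType) (T : topologicalType)
    (V : normedModType R) (f g : T -> V) :
  continuous f -> continuous g -> continuous (fun x => f x + g x).
Proof. by move=> cf cg x; apply: cvgD; [exact: cf | exact: cg]. Qed.

Lemma continuous_dist (R : realType) (T : topologicalType)
    (V : normedModType R) (f : T -> V) (v : V) :
  continuous f -> continuous (fun x => `|v - f x|).
Proof.
by move=> cf x; apply: cvg_norm; apply: cvgB; [exact: cvg_cst | exact: cf].
Qed.

Lemma continuous_compose (T U V : topologicalType) (f : T -> U) (g : U -> V) :
  continuous f -> continuous g -> continuous (fun x => g (f x)).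
Proof. by move=> cf cg x; apply: continuous_comp; [exact: cf | exact: cg]. Qed.

Lemma continuous_closed_le (R : realType) (T : topologicalType) (f : T -> R)
    (c : R) :
  continuous f -> closed [set x | c <= f x].
Proof.
move=> cf; have := @preimage_closed _ _ f [set y | c <= y].
by apply; [move=> x _; exact: cf | exact: closed_ge].
Qed.

Lemma continuous_closed_le2 (R : realType) (T : topologicalType)
    (f g : T -> R) :
  continuous f -> continuous g -> closed [set x | f x <= g x].
Proof.
move=> cf cg; rewrite (_ : [set x | _] = [set x | 0 <= (g - f) x]).
  by apply: continuous_closed_le => x; apply: cvgB; [exact: cg | exact: cf].
by apply/seteqP; split=> x; rewrite /= -[(g - f) x]/(g x - f x) subr_ge0.
Qed.

Lemma compact_pos_lbound (R : realType) (T : topologicalType) (K : set T)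
    (f : T -> R) :
  compact K -> continuous f -> (forall x, K x -> 0 < f x) ->
  exists2 d : R, 0 < d & forall x, K x -> d <= f x.
Proof.
move=> cK cf f0; have [K0|K0] := pselect (K !=set0); last first.
  by exists 1 => // x Kx; exfalso; apply: K0; exists x.
have [c Kc fc] := compact_EVT_min K0 cK (continuous_subspaceT cf).
by exists (f c) => [|x Kx]; [apply: f0; rewrite inE in Kc | apply: fc; rewrite inE].
Qed.

Lemma compact_ubound (R : realType) (T : topologicalType) (K : set T)
    (f : T -> R) :
  compact K -> continuous f -> exists2 d : R, 0 < d & forall x, K x -> f x <= d.
Proof.
move=> cK cf; have [K0|K0] := pselect (K !=set0); last first.
  by exists 1 => // x Kx; exfalso; apply: K0; exists x.
have [c Kc fc] := compact_EVT_max K0 cK (continuous_subspaceT cf).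
exists (`|f c| + 1) => [|x Kx]; first by rewrite ltr_wpDl.
by rewrite (le_trans (fc x _)) ?inE// (le_trans (ler_norm _))// lerDl.
Qed.

(** The pairs on which f varies by at least e form a compact set on which the
    distance is positive. *)
Lemma compact_uniform_continuous (R : realType) (V W : normedModType R)
    (K : set V) (f : V -> W) :
  compact K -> continuous f -> forall e : R, 0 < e ->
  exists2 d : R, 0 < d &
    forall x y, K x -> K y -> `|x - y| < d -> `|f x - f y| < e.
Proof.
move=> cK cf e e0.
pose D : set (V * V)%type := (K `*` K) `&` [set p | e <= `|f p.1 - f p.2|].
have cD : compact D.
  apply: compact_closedI; first exact: compact_setX.
  apply: continuous_closed_le => p; apply: cvg_norm; apply: cvgB.
    by apply: continuous_cvg; [exact: cf | exact: cvg_fst].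
  by apply: continuous_cvg; [exact: cf | exact: cvg_snd].
have cn : continuous (fun p : (V * V)%type => `|p.1 - p.2|).
  by move=> p; apply: cvg_norm; apply: cvgB; [exact: cvg_fst | exact: cvg_snd].
have [p [_ /= ep]|d d0 dP] := compact_pos_lbound cD cn.
  rewrite normr_gt0 subr_eq0; apply/eqP => p12.
  by move: ep; rewrite p12 subrr normr0 leNgt e0.
exists d => // x y Kx Ky xy; rewrite ltNge; apply/negP => exy.
by move: xy; rewrite ltNge (dP (x, y)).
Qed.

(** * Coordinates *)

Section coordinates.
Context {R : realType} {T : finType}.
Implicit Types (x y : 'rV[R]_#|T|) (k : T).

Lemma coord_vect (f : T -> R) k : coord (vect f) k = f k.
Proof. by rewrite /coord /vect mxE enum_rankK. Qed.

Lemma coordP x y : (forall k, coord x k = coord y k) -> x = y.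
Proof.
move=> xy; apply/rowP => i.
by have := xy (enum_val i); rewrite /coord enum_valK.
Qed.

Lemma coordD x y k : coord (x + y) k = coord x k + coord y k.
Proof. by rewrite /coord mxE. Qed.

Lemma coordB x y k : coord (x - y) k = coord x k - coord y k.
Proof. by rewrite /coord !mxE. Qed.

Lemma coordZ (c : R) x k : coord (c *: x) k = c * coord x k.
Proof. by rewrite /coord mxE. Qed.

Lemma coord_sum (I : Type) (s : seq I) (P : pred I) (F : I -> 'rV[R]_#|T|) k :
  coord (\sum_(i <- s | P i) F i) k = \sum_(i <- s | P i) coord (F i) k.
Proof. by rewrite /coord summxE. Qed.

Lemma coord0 k : coord (0 : 'rV[R]_#|T|) k = 0.
Proof. by rewrite /coord mxE. Qed.

Lemma coord_vertex k l : coord (vertex R k) l = (l == k)%:R.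
Proof. by rewrite /vertex coord_vect. Qed.

Lemma sum_coord_vertex x : x = \sum_(k : T) coord x k *: vertex R k.
Proof.
apply: coordP => l; rewrite coord_sum (bigD1 l)//= coordZ coord_vertex eqxx mulr1.
rewrite big1 ?addr0// => k /negPf kl.
by rewrite coordZ coord_vertex eq_sym kl mulr0.
Qed.

Lemma continuous_coord k : continuous (fun x => coord x k).
Proof. exact: coord_continuous. Qed.

Lemma coord_le_norm x k : `|coord x k| <= `|x|.
Proof.
rewrite [leRHS]mx_normrE.
exact: (le_bigmax _ (fun ij => `|x ij.1 ij.2|) (0, enum_rank k)).
Qed.

Lemma norm_le_coord x (c : R) : 0 <= c -> (forall k, `|coord x k| <= c) -> `|x| <= c.
Proof.
move=> c0 h; rewrite [leLHS]mx_normrE; apply/bigmax_leP; split => // -[i j] _ /=.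
by rewrite (ord1 i); have := h (enum_val j); rewrite /coord enum_valK.
Qed.

Definition dotp x y := \sum_(k : T) coord x k * coord y k.

Lemma dotpDr x y y' : dotp x (y + y') = dotp x y + dotp x y'.
Proof. by rewrite -big_split; apply: eq_bigr => k _; rewrite coordD mulrDr. Qed.

Lemma dotpZr x (c : R) y : dotp x (c *: y) = c * dotp x y.
Proof. by rewrite mulr_sumr; apply: eq_bigr => k _; rewrite coordZ mulrCA. Qed.

Lemma dotpBr x y y' : dotp x (y - y') = dotp x y - dotp x y'.
Proof. by rewrite dotpDr -scaleN1r dotpZr mulN1r. Qed.

Lemma dotpBl x x' y : dotp (x - x') y = dotp x y - dotp x' y.
Proof. by rewrite -sumrB; apply: eq_bigr => k _; rewrite coordB mulrBl. Qed.

Lemma continuous_dotp (U : topologicalType) (f : U -> 'rV[R]_#|T|) y :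
  continuous f -> continuous (fun u => dotp (f u) y).
Proof.
move=> cf; rewrite /dotp; apply: continuous_sum_fin => k u.
have cfk := continuous_compose cf (@continuous_coord k).
by apply: cvgM; [exact: cfk | exact: cvg_cst].
Qed.

Lemma simplex_vertex k : simplex (vertex R k).
Proof.
split=> [l|]; first by rewrite coord_vertex ler0n.
rewrite (bigD1 k)//= coord_vertex eqxx big1 ?addr0// => l /negPf lk.
by rewrite coord_vertex lk.
Qed.

Lemma simplex_coord_le1 x k : simplex x -> coord x k <= 1.
Proof.
move=> [x0 <-]; rewrite (bigD1 k)//= lerDl.
by apply: sumr_ge0 => l _.
Qed.

Lemma compact_simplex : compact (@simplex R T).
Proof.
apply: bounded_closed_compact.
  exists 1; split; [exact: num_real|move=> M M1 x sx /=].
  apply: norm_le_coord => [|k]; first by rewrite (le_trans _ (ltW M1)).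
  rewrite ger0_norm; last by case: sx.
  by rewrite (le_trans _ (ltW M1))// simplex_coord_le1.
have cs : continuous (fun x => \sum_(k : T) coord x k).
  by apply: continuous_sum_fin => k; exact: continuous_coord.
have -> : @simplex R T =
    (\bigcap_(k in [set: T]) [set x | 0 <= coord x k]) `&`
    ((fun x => \sum_(k : T) coord x k) @^-1` [set 1]).
  by apply/seteqP; split=> x [x0 x1]; split=> // k; first move=> _; exact: x0.
apply: closedI; first apply: closed_bigI => k _.
  by apply: (@continuous_closed_le _ _ (fun x => coord x k)); exact: continuous_coord.
by apply: preimage_closed => [x _|]; [exact: cs | exact: closed_eq].
Qed.

End coordinates.

(** * Potentials *)

Section potentials.
Context {R : realType} {T : finType}.
Implicit Types (x y v : 'rV[R]_#|T|) (P : 'rV[R]_#|T| -> R).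

Lemma derive_dotp P x v : differentiable P x -> 'D_v P x = dotp (grad P x) v.
Proof.
move=> dP; rewrite deriveE// [in LHS](sum_coord_vertex v) linear_sum.
apply: eq_bigr => k _; rewrite linearZ /= /grad coord_vect deriveE//.
by rewrite mulrC.
Qed.

Lemma derive_le_secant P x v (c : R) : differentiable P x ->
  (forall s, 0 < s -> s <= 1 -> P (x + s *: v) - P x <= s * c) ->
  dotp (grad P x) v <= c.
Proof.
move=> dP sec; rewrite -derive_dotp//.
have dv : derivable P x v by exact: diff_derivable.
rewrite /derive.
apply: (@cvgr_to_le _ (0 : R)^'+ _ _ (fun h => h^-1 *: ((P \o shift x) (h *: v) - P x))).
  exact: cvg_dnbhs_at_right.
near=> h; rewrite /= -[_ *: _]/(_ * _) mulrC ler_pdivrMr; last by near: h; exact: nbhs_right_gt.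
rewrite [c * h]mulrC [h *: v + x]addrC; apply: sec; first by near: h; exact: nbhs_right_gt.
by near: h; apply: nbhs_right_le.
Unshelve. all: by end_near. Qed.

(** The difference quotients of P along the segment from x to y are at most
    P y - P x, and so is their limit. *)
Lemma convex_tangent P x y : convex_function setT P -> differentiable P x ->
  P x + dotp (grad P x) (y - x) <= P y.
Proof.
move=> cP dP; rewrite -lerBrDl; apply: derive_le_secant => // s s0 s1.
have s01 : Itv.spec (Itv.num_sem (R:=R)) (Itv.Real `[0%Z, 1%Z]) s.
  by rewrite /= /Itv.num_sem /= in_itv/= (ltW s0) s1 num_real.
have := cP (Itv.mk s01) y x; rewrite !in_setE => /(_ Logic.I Logic.I).
rewrite convRE /= /unstable.onem.
have -> : conv (Itv.mk s01) (y : convex_lmodType _) x = x + s *: (y - x).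
  rewrite /conv /= scalerBl scale1r scalerBr.
  by rewrite addrCA.
by move=> h; rewrite lerBlDl (le_trans h)//; lra.
Qed.

(** The slopes of - P along any direction are nonpositive at x, so the slopes
    of P are nonnegative along both a direction and its opposite. *)
Lemma grad_at_min P x : differentiable P x -> (forall y, P x <= P y) ->
  grad P x = 0.
Proof.
move=> dP minx.
have dNP : differentiable (- P) x by exact: differentiableN.
have ge0 v : 0 <= dotp (grad P x) v.
  rewrite -oppr_le0 -derive_dotp// -deriveN; last exact: diff_derivable.
  rewrite derive_dotp//; apply: derive_le_secant => // s s0 s1.
  by rewrite mulr0 -[(- P) _]/(- _) -[(- P) x]/(- _) opprK addrC subr_le0.
apply: coordP => k; rewrite coord0.
suff -> : coord (grad P x) k = dotp (grad P x) (vertex R k).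
  apply/eqP; rewrite eq_le ge0 andbT -oppr_ge0.
  by rewrite -mulN1r -dotpZr ge0.
rewrite /dotp (bigD1 k)//= coord_vertex eqxx mulr1 big1 ?addr0// => l /negPf lk.
by rewrite coord_vertex lk mulr0.
Qed.

(** A zero of P is a minimum, where the gradient vanishes; outside the orthant
    this contradicts the positivity of the gradient along x. *)
Lemma potential_eq0 P x : potential P -> P x = 0 <-> nonpos_orthant x.
Proof.
move=> [dP [_ [_ [P0 [Pz [_ [P2 _]]]]]]]; split; last exact: Pz.
move=> Px; apply: contrapT => /P2.
have -> : grad P x = 0 by apply: grad_at_min => // y; rewrite Px.
by rewrite big1 ?ltxx// => k _; rewrite coord0 mul0r.
Qed.

Lemma potential_continuous P : potential P -> continuous P.
Proof. by case=> dP _ x; exact: differentiable_continuous. Qed.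

Lemma grad_continuous P : potential P -> continuous (grad P).
Proof. by case=> _ [dP _] x; exact: differentiable_continuous. Qed.

End potentials.

(** * Empirical distributions *)

Section empirical_distributions.
Context {R : realType} {S : finType}.
Implicit Types (h : seq S) (a : S).

Lemma empirical_rcons h a :
  (size h).+1%:R *: empirical R (rcons h a) =
  (size h)%:R *: empirical R h + vertex R a.
Proof.
rewrite /empirical size_rcons !scalerA mulfV ?pnatr_eq0// scale1r -cats1.
rewrite big_cat big_seq1 /=; congr (_ + _).
case: h => [|b h]; first by rewrite big_nil scaler0.
by rewrite mulfV ?pnatr_eq0// scale1r.
Qed.

Lemma empirical_step h a :
  empirical R (rcons h a) - empirical R h =
  (size h).+1%:R^-1 *: (vertex R a - empirical R h).
Proof.
apply: (@scalerI _ _ (size h).+1%:R); first by rewrite pnatr_eq0.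
rewrite scalerBr empirical_rcons [RHS]scalerA mulfV ?pnatr_eq0// scale1r.
by rewrite -natr1 scalerDl scale1r opprD addrACA subrr add0r addrC.
Qed.

Lemma simplex_empirical h : (0 < size h)%N -> simplex (empirical R h).
Proof.
move=> h0; have sE k : coord (empirical R h) k =
    (size h)%:R^-1 * \sum_(a <- h) (k == a)%:R.
  rewrite coordZ coord_sum; congr (_ * _).
  by apply: eq_bigr => a _; rewrite coord_vertex.
split=> [k|]; first by rewrite sE mulr_ge0 ?invr_ge0 ?ler0n// sumr_ge0.
under eq_bigr do rewrite sE.
rewrite -mulr_sumr exchange_big /= (eq_bigr (fun=> 1)) => [|a _].
  by rewrite big_const_seq count_predT iter_addr_0 mulVf// pnatr_eq0 -lt0n.
by rewrite (bigD1 a)//= eqxx big1 ?addr0// => k /negPf ->.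
Qed.

Lemma norm_simplexB (x y : 'rV[R]_#|S|) : simplex x -> simplex y -> `|x - y| <= 1.
Proof.
move=> sx sy; apply: norm_le_coord => // k; rewrite coordB.
have [x0 y0] : 0 <= coord x k /\ 0 <= coord y k by case: sx; case: sy.
have x1 := simplex_coord_le1 k sx; have y1 := simplex_coord_le1 k sy.
by rewrite ler_norml; apply/andP; split; lra.
Qed.

End empirical_distributions.

(** * Expectations over finite continuations of a history *)

(** After a history, the play is a finite tree, so that conditional
    expectations are iterated finite sums. *)
Section expectation.
Context {R : realType} {S : finType} (Q : seq S -> S -> R).
Implicit Types (f g : seq S -> R) (h : seq S).

Fixpoint expect n f h : R :=
  if n is m.+1 then \sum_(a : S) Q h a * expect m f (rcons h a) else f h.

Hypothesis Q0 : forall h a, 0 <= Q h a.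

Lemma le_expect n f g h : (forall h, f h <= g h) -> expect n f h <= expect n g h.
Proof.
move=> fg; elim: n h => [|n IH] h //=.
by apply: ler_sum => a _; apply: ler_wpM2l.
Qed.

Lemma expect_contract (W : seq S -> R) (rho : R) (T : nat) : 0 <= rho ->
  (forall h, (T <= size h)%N ->
     \sum_(a : S) Q h a * W (rcons h a) <= rho * W h) ->
  forall n h, (T <= size h)%N -> expect n W h <= rho ^+ n * W h.
Proof.
move=> rho0 WP; elim=> [|n IH] h Th /=; first by rewrite mul1r.
rewrite exprS -mulrA mulrCA; apply: (le_trans _ (ler_wpM2l _ (WP h Th))).
  rewrite mulr_sumr; apply: ler_sum => a _.
  rewrite mulrCA; apply: ler_wpM2l => //; apply: IH.
  by rewrite size_rcons (leq_trans Th).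
exact: exprn_ge0.
Qed.

End expectation.

(** * Decay of the potential of the regret *)

(** From the inverse of 1 - x <= expR (- x). *)
Lemma expR_le_quad (R : realType) (x : R) : x <= 2^-1 ->
  expR x <= 1 + x + 2 * x ^+ 2.
Proof.
move=> x2; have := expR_ge1Dx (- x); rewrite expRN => h.
have x1 : 0 < 1 - x by lra.
rewrite -(invrK (expR x)) (@le_trans _ _ (1 - x)^-1)//.
  by rewrite lef_pV2 ?posrE// invr_gt0 expR_gt0.
rewrite -[leLHS]mul1r ler_pdivrMr//.
have -> : (1 + x + 2 * x ^+ 2) * (1 - x) = 1 + x ^+ 2 * (1 - 2 * x) by ring.
by rewrite lerDl mulr_ge0 ?sqr_ge0//; lra.
Qed.

Section decay.
Context {R : realType} {S A : finType}.
Variables (r : S -> 'rV[R]_#|A|) (P : 'rV[R]_#|A| -> R) (Q : seq S -> S -> R).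

Definition mean_vector (z : 'rV[R]_#|S|) : 'rV[R]_#|A| :=
  \sum_(a : S) coord z a *: r a.

Let x h := mean_vector (empirical R h).

Hypothesis potP : potential P.
Hypothesis Q0 : forall h a, 0 <= Q h a.
Hypothesis Q1 : forall h, \sum_(a : S) Q h a = 1.
Hypothesis QP : forall h, (0 < size h)%N ->
  \sum_(a : S) Q h a * dotp (grad P (x h)) (r a) = 0.

Lemma mean_vectorB z z' :
  mean_vector (z - z') = mean_vector z - mean_vector z'.
Proof. by rewrite -sumrB; apply: eq_bigr => a _; rewrite coordB scalerBl. Qed.

Lemma mean_vectorZ c z : mean_vector (c *: z) = c *: mean_vector z.
Proof. by rewrite scaler_sumr; apply: eq_bigr => a _; rewrite coordZ scalerA. Qed.

Lemma mean_vector_vertex a : mean_vector (vertex R a) = r a.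
Proof.
rewrite /mean_vector (bigD1 a)//= coord_vertex eqxx scale1r big1 ?addr0// => b.
by move=> /negPf ba; rewrite coord_vertex ba scale0r.
Qed.

Lemma continuous_mean_vector : continuous mean_vector.
Proof.
apply: continuous_sum_fin => a.
by apply: (@continuous_scale _ _ _ (fun z => coord z a)); exact: continuous_coord.
Qed.

(** The tangent plane at the new point bounds its potential from above by that
    of the old point; the tangent plane at the old point, compared with the
    origin, replaces one copy of P (x h) by a scalar product.  What remains is
    the change of the gradient between the two points. *)
Lemma potential_step h a : (size h).+1%:R * P (x (rcons h a)) <=
  (size h)%:R * P (x h) + dotp (grad P (x h)) (r a) +
  dotp (grad P (x (rcons h a)) - grad P (x h)) (r a - x h).
Proof.
have [dP [_ [cP [_ [Pz _]]]]] := potP.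
set t := size h; set y := x (rcons h a).
have t0 : 0 < t.+1%:R :> R by rewrite ltr0n.
have xy : t.+1%:R *: (x h - y) = - (r a - x h).
  rewrite -[x h - y]opprB scalerN -mean_vectorB empirical_step mean_vectorZ.
  by rewrite scalerA mulfV ?gt_eqF// scale1r mean_vectorB mean_vector_vertex.
have h1 := convex_tangent (x h) cP (dP y).
have h2 : P (x h) - dotp (grad P (x h)) (x h) <= 0.
  have := convex_tangent 0 cP (dP (x h)).
  by rewrite dotpBr [P 0]Pz => [|k]; rewrite ?coord0// /dotp big1 ?sub0r// => k _; rewrite coord0 mulr0.
have {h1} : t.+1%:R * P y - dotp (grad P y) (r a - x h) <= t.+1%:R * P (x h).
  rewrite -mulN1r -dotpZr scaleN1r -xy dotpZr -mulrDr.
  by rewrite ler_pM2l.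
by rewrite -natr1 !dotpBr !dotpBl mulrDl mul1r; lra.
Qed.

(** Empirical distributions of consecutive histories are within 1/(t + 1) of
    each other, and the gradient is uniformly continuous along the compact
    image of the simplex. *)
Lemma potential_drift (e : R) : 0 < e -> exists T : nat,
  forall h a, (T < size h)%N ->
  (size h).+1%:R * P (x (rcons h a)) <=
  (size h)%:R * P (x h) + dotp (grad P (x h)) (r a) + e.
Proof.
move=> e0.
have cD : continuous (fun z => \sum_(a : S) `|r a - mean_vector z|).
  by apply: continuous_sum_fin => a; apply: continuous_dist; exact: continuous_mean_vector.
have [M M0 MP] := compact_ubound compact_simplex cD.
have cG : continuous (fun z => grad P (mean_vector z)).
  apply: continuous_compose; last exact: grad_continuous.
  exact: continuous_mean_vector.
have A1 : 0 < #|A|%:R + 1 :> R by rewrite ltr_wpDl.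
have e'0 : 0 < e / (M * (#|A|%:R + 1)) by rewrite divr_gt0 // mulr_gt0.
have [d d0 dP] := compact_uniform_continuous compact_simplex cG e'0.
exists (Num.bound d^-1) => h a Th; apply: (le_trans (potential_step h a)).
rewrite lerD2l.
have h0 : (0 < size h)%N by exact: leq_trans Th.
have sh := simplex_empirical (R := R) h0.
have sha : simplex (empirical R (rcons h a)) by apply: simplex_empirical; rewrite size_rcons.
set g := _ - _; set y := _ - _.
have gP : `|g| < e / (M * (#|A|%:R + 1)).
  apply: dP => //; rewrite empirical_step normrZ ger0_norm ?invr_ge0 ?ler0n//.
  rewrite mulrC ltr_pdivrMr ?ltr0n//.
  apply: (le_lt_trans (norm_simplexB (simplex_vertex a) sh)).
  rewrite -ltr_pdivrMl// mulr1.
  have /archi_boundP /lt_le_trans : 0 <= d^-1 by rewrite invr_ge0 ltW.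
  apply.
  by rewrite ler_nat; lia.
have yP : `|y| <= M.
  apply: le_trans (MP _ sh); rewrite (bigD1 a)//= lerDl.
  exact: sumr_ge0.
apply: (@le_trans _ _ (\sum_(k : A) (e / (M * (#|A|%:R + 1)) * M))).
  apply: ler_sum => k _; apply: (le_trans (ler_norm _)); rewrite normrM.
  apply: ler_pM => //; first exact: le_trans (coord_le_norm _ _) (ltW gP).
  exact: le_trans (coord_le_norm _ _) yP.
have -> : e / (M * (#|A|%:R + 1)) * M = e / (#|A|%:R + 1).
  by field; rewrite !gt_eqF.
rewrite sumr_const -[leLHS]mulr_natr mulrAC ler_pdivrMr// ler_pM2l//.
by rewrite lerDl.
Qed.

(** For small theta, the exponential of theta t (P(x(t)) - eta) is a strict
    supermartingale: to first order in theta its drift is at most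
    - theta (eta - e) with e small, by the drift of t P(x(t)), and the terms of
    order two are bounded. *)
Lemma exp_potential_contract (eta : R) : 0 < eta ->
  exists2 theta : R, 0 < theta & exists T : nat, forall h, (T < size h)%N ->
  \sum_(a : S) Q h a *
    expR (theta * ((size (rcons h a))%:R * (P (x (rcons h a)) - eta))) <=
  expR (- (theta * eta / 2)) * expR (theta * ((size h)%:R * (P (x h) - eta))).
Proof.
move=> eta0.
have cf : continuous (fun z => \sum_(a : S) `|dotp (grad P (mean_vector z)) (r a)|).
  apply: continuous_sum_fin => a.
  apply: continuous_compose; last exact: norm_continuous.
  apply: continuous_dotp.
  apply: continuous_compose; last exact: grad_continuous.
  exact: continuous_mean_vector.
(* C bounds the scalar products of the gradient with the pure regrets. *)
have [C C0 CP] := compact_ubound compact_simplex cf.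
have e40 : 0 < eta / 4 by rewrite divr_gt0.
have [T TP] := potential_drift e40.
(* The first bound puts theta times the scalar product in the range of the
   quadratic estimate of the exponential; the second keeps the quadratic term
   below theta eta / 4. *)
pose theta := Num.min (2^-1 / C) (eta / 8 / C ^+ 2).
have theta0 : 0 < theta by rewrite lt_min !divr_gt0 ?invr_gt0 ?exprn_gt0.
have thC : theta * C <= 2^-1 by rewrite -ler_pdivlMr// ge_min lexx.
have thC2 : theta * C ^+ 2 <= eta / 8.
  by rewrite -ler_pdivlMr ?exprn_gt0// ge_min lexx orbT.
exists theta => //; exists T => h Th.
have sh : simplex (empirical R h) by apply: simplex_empirical; exact: leq_trans Th.
pose Y a := dotp (grad P (x h)) (r a).
have YC a : `|Y a| <= C.
  by apply: le_trans (CP _ sh); rewrite (bigD1 a)//= lerDl; exact: sumr_ge0.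
set w := (size h)%:R * (P (x h) - eta).
(* The first-order term, linear in Y, is kept apart because its mean is 0. *)
have step a : expR (theta * ((size (rcons h a))%:R * (P (x (rcons h a)) - eta)))
    <= expR (theta * (w - eta * 3 / 4)) * (1 + theta * Y a + 2 * (theta * C) ^+ 2).
  rewrite size_rcons; have thY : theta * Y a <= 2^-1.
    apply: le_trans thC; rewrite ler_pM2l//; exact: le_trans (ler_norm _) (YC a).
  apply: (@le_trans _ _ (expR (theta * (w - eta * 3 / 4) + theta * Y a))).
    rewrite ler_expR -mulrDr ler_pM2l//.
    have := TP h a Th; rewrite -/(Y a) /w -natr1 => hT.
    by rewrite mulrBr [leRHS]addrAC; lra.
  rewrite expRD ler_wpM2l ?expR_ge0//; apply: (le_trans (expR_le_quad thY)).
  rewrite lerD2l ler_pM2l// !exprMn ler_pM2l ?exprn_gt0//.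
  by rewrite -[leLHS]real_normK ?num_real// lerXn2r ?nnegrE// ltW.
apply: (@le_trans _ _ (\sum_(a : S) Q h a *
    (expR (theta * (w - eta * 3 / 4)) * (1 + theta * Y a + 2 * (theta * C) ^+ 2)))).
  by apply: ler_sum => a _; apply: ler_wpM2l.
have -> : \sum_(a : S) Q h a * (expR (theta * (w - eta * 3 / 4)) *
      (1 + theta * Y a + 2 * (theta * C) ^+ 2)) =
    expR (theta * (w - eta * 3 / 4)) * (1 + 2 * (theta * C) ^+ 2).
  transitivity (expR (theta * (w - eta * 3 / 4)) *
     (\sum_a Q h a * (1 + 2 * (theta * C) ^+ 2) + theta * \sum_a Q h a * Y a)).
    rewrite mulr_sumr -big_split /= mulr_sumr; apply: eq_bigr => a _; ring.
  by rewrite -mulr_suml Q1 QP ?(leq_trans _ Th)// mulr0 addr0 mul1r.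
rewrite -expRD (le_trans (ler_wpM2l (expR_ge0 _) (expR_ge1Dx _)))//.
rewrite -expRD ler_expR exprMn.
by have := ler_wpM2l (ltW theta0) thC2; lra.
Qed.

Definition exceeds (eta : R) (h : seq S) : R := (eta <= P (x h))%R%:R.

(** Markov's inequality for the exponential supermartingale. *)
Lemma potential_concentration (eta : R) : 0 < eta ->
  exists2 rho : R, 0 < rho < 1 & exists T : nat, forall h, (T < size h)%N ->
  (exists2 K : R, 0 <= K &
     forall n, expect Q n (exceeds eta) h <= K * rho ^+ n) /\
  (P (x h) <= eta / 2 ->
     forall n, expect Q n (exceeds eta) h <= rho ^+ (size h + n)).
Proof.
move=> eta0; have [theta th0 [T TP]] := exp_potential_contract eta0.
set rho := expR _ in TP.
have rho0 : 0 < rho by exact: expR_gt0.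
pose W h := expR (theta * ((size h)%:R * (P (x h) - eta))).
have key n h : (T < size h)%N ->
    expect Q n (exceeds eta) h <= rho ^+ n * W h.
  move=> Th; apply: (@le_trans _ _ (expect Q n W h)); last first.
    by apply: (@expect_contract _ _ Q Q0 W rho T.+1) => //; exact: ltW.
  apply: le_expect => // g; rewrite /exceeds.
  have [eg|_] := leP eta (P (x g)); last exact: expR_ge0.
  rewrite -expR0 ler_expR; apply: mulr_ge0; first exact: ltW.
  by rewrite mulr_ge0// subr_ge0.
exists rho; first by rewrite rho0 expR_lt1 oppr_lt0 divr_gt0// mulr_gt0.
exists T => h Th; split.
  by exists (W h) => [|n]; [exact: expR_ge0 | rewrite mulrC key].
move=> Ph n; rewrite (le_trans (key n h Th))// addnC exprD ler_pM2l ?exprn_gt0//.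
rewrite /W /rho -expRM_natl ler_expR.
have tm : 0 <= theta * (size h)%:R by rewrite mulr_ge0// ltW.
have PE : P (x h) - eta <= - (eta / 2) by lra.
by have := ler_wpM2l tm PE; lra.
Qed.

End decay.

(** * Histories as random variables *)

Lemma negligible_exists (R : realType) (d : measure_display)
    (Omega : measurableType d) (P : probability Omega R) (I : countType)
    (F : I -> set Omega) :
  (forall i, P.-negligible (F i)) -> P.-negligible [set w | exists i, F i w].
Proof.
move=> F0; apply: (@negligibleS _ _ _ _ (\bigcup_n
   (if unpickle n is Some i then F i else set0))).
  by move=> w [i Fi]; exists (pickle i) => //; rewrite pickleK.
apply: negligible_bigcup => n; case: (unpickle n) => [i|]; first exact: F0.
exact: (negligible_set0 P).
Qed.

Section process.
Context {R : realType} {S : finType} {d : measure_display}.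
Context {Omega : measurableType d}.
Variables (P : probability Omega R) (act : nat -> Omega -> S).
Variable (Q : seq S -> S -> R).
Implicit Types (D : seq S -> Prop) (h : seq S) (t : nat).

Let H h := [set w | history act (size h) w = h].

Hypothesis mact : forall t a, measurable [set w | act t.+1 w = a].
Hypothesis Q0 : forall h a, 0 <= Q h a.
Hypothesis law : forall h a, (0 < P (H h))%E ->
  P ([set w | act (size h).+1 w = a] `&` H h) = (P (H h) * (Q h a)%:E)%E.

Lemma historyS t w : history act t.+1 w = rcons (history act t w) (act t.+1 w).
Proof. by rewrite /history -{1}(addn1 t) iotaD map_cat /= cats1 add1n. Qed.

Lemma size_history t w : size (history act t w) = t.
Proof. by rewrite size_map size_iota. Qed.

Lemma measurable_history t D : measurable [set w | D (history act t w)].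
Proof.
elim: t D => [|t IH] D.
  have [D0|nD] := pselect (D [::]).
    by rewrite (_ : [set _ | _] = setT) //; apply/seteqP; split.
  by rewrite (_ : [set _ | _] = set0) //; apply/seteqP; split.
rewrite (_ : [set _ | _] = \bigcup_(a in [set: S])
    ([set w | act t.+1 w = a] `&` [set w | D (rcons (history act t w) a)])).
  by apply: fin_bigcup_measurable => // a _; apply: measurableI; [|exact: (IH (fun h => D (rcons h a)))].
apply/seteqP; split=> w /=; rewrite historyS.
  by exists (act t.+1 w).
by case=> a _ [<-].
Qed.

Lemma measurable_H h : measurable (H h).
Proof. exact: (measurable_history (size h) (fun g => g = h)). Qed.

Lemma measurable_H_history h t (D : pred (seq S)) :
  measurable (H h `&` [set w | D (history act t w)]).
Proof.
apply: measurableI; first exact: measurable_H.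
exact: (measurable_history t (fun g => D g)).
Qed.

Lemma HS h a :
  H (rcons h a) = [set w | act (size h).+1 w = a] `&` H h.
Proof.
apply/seteqP; split=> w; rewrite /H /= size_rcons historyS.
  by move=> /rcons_inj[].
by case=> -> ->.
Qed.

Lemma prob_rcons h a : P (H (rcons h a)) = (P (H h) * (Q h a)%:E)%E.
Proof.
rewrite HS; have [h0|] := ltP 0%E (P (H h)); first exact: law.
rewrite measure_le0 => /eqP h0; rewrite h0 mul0e.
by apply/eqP; rewrite -measure_le0 -h0; apply: le_measure; rewrite ?inE//;
  [apply: measurableI => //; exact: measurable_H | exact: measurable_H].
Qed.

Lemma prob_split t (E : set Omega) : measurable E ->
  P E = (\sum_(a : S) P ([set w | act t.+1 w = a] `&` E))%E.
Proof.
move=> mE; rewrite [in LHS](_ : E = \bigcup_(a in [set: S])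
    ([set w | act t.+1 w = a] `&` E)).
  rewrite measure_fin_bigcup//.
  - rewrite [RHS]fsbig_seq ?index_enum_uniq//; apply: eq_fsbigl.
    by apply/seteqP; split=> a //= _; rewrite mem_index_enum.
  - exact: finite_finset.
  - by move=> a b _ _ [w [[/= <- _] [<-]]].
  - by move=> a _; apply: measurableI.
by apply/seteqP; split=> w; [exists (act t.+1 w) | case=> a _ []].
Qed.

(** By induction on n, splitting on the first action after h. *)
Lemma prob_expect n h (D : pred (seq S)) :
  P (H h `&` [set w | D (history act (size h + n) w)]) =
  (P (H h) * (expect Q n (fun g => (D g)%:R) h)%:E)%E.
Proof.
elim: n h => [|n IH] h /=.
  rewrite addn0; case Dh: (D h); rewrite ?mule1 ?mule0.
    congr (P _); apply/seteqP; split=> w; first by case.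
    by move=> Hw; split=> //=; rewrite Hw.
  rewrite (_ : _ `&` _ = set0) ?measure0//.
  by apply/seteqP; split=> w // -[/= ->]; rewrite Dh.
rewrite (prob_split (size h)); last exact: measurable_H_history.
rewrite -sumEFin ge0_sume_distrr; last first.
  move=> a _; rewrite lee_fin mulr_ge0//.
  by elim: n {IH} (rcons h a) => [|n IH] g /=; rewrite ?ler0n// sumr_ge0// => b _; rewrite mulr_ge0.
apply: eq_bigr => a _.
rewrite setIA -HS -addSnnS -(size_rcons h a) IH prob_rcons EFinM muleA.
by [].
Qed.

(** There are countably many histories, and those of probability zero are
    negligible; hence almost surely every action taken had positive
    probability. *)
Lemma negligible_null_history :
  P.-negligible [set w | exists t, ~~ (0 < P (H (history act t w)))%E].
Proof.
apply: (@negligibleS _ _ _ _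
  [set w | exists h, (if (0 < P (H h))%E then set0 else H h) w]).
  move=> w [t tP]; exists (history act t w).
  by rewrite (negPf tP) /H /mkset (size_history t w).
apply: negligible_exists => h.
have [_|] := ltP 0%E (P (H h)); first exact: (negligible_set0 P).
by rewrite measure_le0 => /eqP h0; apply/negligibleP => //; exact: measurable_H.
Qed.

Lemma geometric_eseries_le (u : nat -> \bar R) (c rho : R) : 0 <= c ->
  0 < rho < 1 -> (forall n, (0 <= u n)%E) ->
  (forall n, (u n <= (c * rho ^+ n)%:E)%E) ->
  (\sum_(0 <= n <oo) u n <= (c / (1 - rho))%:E)%E.
Proof.
move=> c0 /andP[r0 r1] u0 uc; apply: lime_le; first exact: is_cvg_nneseries.
near=> n; apply: (@le_trans _ _ (\sum_(0 <= i < n) (c * rho ^+ i)%:E)%E).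
  by apply: lee_sum => i _.
rewrite sumEFin lee_fin.
have := @geometric_le_lim R n c rho c0 r0; apply.
by rewrite ger0_norm// ltW.
Unshelve. all: by end_near. Qed.

(** Given h, the event at length size h + n has probability at most
    rho ^+ (size h + n), so the union is bounded by a geometric series. *)
Lemma prob_eventually_bad h (D : pred (seq S)) (rho : R) : 0 < rho < 1 ->
  (forall n, expect Q n (fun g => (D g)%:R) h <= rho ^+ (size h + n)) ->
  (P (H h `&` \bigcup_n [set w | D (history act (size h + n) w)]) <=
   P (H h) * (rho ^+ size h / (1 - rho))%:E)%E.
Proof.
move=> r01 hr; rewrite setI_bigcupr.
have fP : P (H h) = (fine (P (H h)))%:E.
  by rewrite fineK// fin_num_measure//; exact: measurable_H.
apply: (le_trans (@measure_sigma_subadditive _ _ _ P _ _ _ _ (@subset_refl _ _))).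
- by move=> n; exact: measurable_H_history.
- by apply: bigcupT_measurable => n; exact: measurable_H_history.
rewrite fP -EFinM mulrA; apply: geometric_eseries_le => //.
  rewrite mulr_ge0 ?fine_ge0// exprn_ge0//; apply: ltW.
  by case/andP: r01.
move=> n; have /= -> := prob_expect n h D; rewrite fP -EFinM lee_fin -mulrA -exprD.
by rewrite ler_wpM2l ?fine_ge0.
Qed.

(** The first Borel-Cantelli lemma, applied after each of the countably many
    histories of length T + 1. *)
Lemma negligible_infinitely_often (D : pred (seq S)) (rho : R) (T : nat) :
  0 < rho < 1 ->
  (forall h, (T < size h)%N -> exists2 K : R, 0 <= K &
     forall n, expect Q n (fun g => (D g)%:R) h <= K * rho ^+ n) ->
  P.-negligible [set w | forall N, exists2 t, (N <= t)%N & D (history act t w)].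
Proof.
move=> r01 DK.
pose F h n := H h `&` [set w | D (history act (size h + n) w)].
apply: (@negligibleS _ _ _ _
  [set w | exists h, (if (T < size h)%N then lim_sup_set (F h) else set0) w]).
  move=> w io; exists (history act T.+1 w).
  rewrite size_history ltnSn => N _.
  have [t Nt Dt] := io (T.+1 + N)%N.
  exists (t - T.+1)%N; first by rewrite /=; lia.
  split; first by rewrite /H /mkset (size_history T.+1 w).
  by rewrite /mkset size_history subnKC//; lia.
apply: negligible_exists => h.
case: ltnP => Th; last exact: (negligible_set0 P).
have mF m : measurable (F h m) by exact: measurable_H_history.
apply/negligibleP.
  apply: bigcapT_measurable => k; apply: bigcup_measurable => j _; exact: mF.
apply: lim_sup_set_cvg0 => //.
have [K K0 KP] := DK h Th.
apply: (@le_lt_trans _ _ (K / (1 - rho))%:E); last exact: ltry.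
apply: geometric_eseries_le => // m; have /= -> := prob_expect m h D.
have h1 : (P (H h) <= 1)%E by apply: probability_le1; exact: measurable_H.
apply: (@le_trans _ _ (1 * (K * rho ^+ m)%:E)%E); last by rewrite mul1e.
apply: (@le_trans _ _ (P (H h) * (K * rho ^+ m)%:E)%E).
  by apply: lee_wpmul2l => //; rewrite lee_fin.
apply: lee_wpmul2r => //; rewrite lee_fin mulr_ge0// exprn_ge0//.
by case/andP: r01 => /ltW.
Qed.

End process.

(** * Regret and best replies of one player *)

Section maxf.
Context {R : realType} {T : finType}.
Implicit Type f : T -> R.

Lemma maxf_leP f (c : R) (k0 : T) : reflect (forall k, f k <= c) (maxf f <= c).
Proof.
have ub : has_ubound (range f).
  exists (\sum_(k : T) `|f k|) => _ [k _ <-].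
  by rewrite (le_trans (ler_norm _))// (bigD1 k)//= lerDl sumr_ge0.
apply: (iffP idP) => [fc k|fc].
  by apply: le_trans fc; apply: ub_le_sup => //; exists k.
by apply: ge_sup; [exists (f k0), k0 | move=> _ [k _ <-]].
Qed.

Lemma le_maxf f (k : T) : f k <= maxf f.
Proof. exact: (maxf_leP f (maxf f) k _). Qed.

End maxf.

(** The maps own and other are the two projections of a profile, in either
    order, so that each lemma serves both players. *)
Section player.
Context {R : realType} {S A B : finType}.
Variables (own : S -> A) (other : S -> B) (u : A -> B -> R).
Implicit Types (z : 'rV[R]_#|S|) (y : 'rV[R]_#|B|) (k l : A).

Definition pure_regret (a : S) : 'rV[R]_#|A| :=
  vect (fun k => u k (other a) - u (own a) (other a)).

Let reg := mean_vector pure_regret.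

Lemma coord_marginal (T : finType) (p : S -> T) z (k : T) :
  coord (marginal p z) k = \sum_(a | p a == k) coord z a.
Proof. exact: coord_vect. Qed.

Lemma simplex_marginal (T : finType) (p : S -> T) z :
  simplex z -> simplex (marginal p z).
Proof.
move=> [z0 z1]; split=> [k|].
  by rewrite coord_marginal sumr_ge0.
rewrite -z1 [RHS](partition_big p predT)//=.
by apply: eq_bigr => k _; rewrite coord_marginal.
Qed.

Lemma mixed_payoff_vertex k y :
  mixed_payoff u (vertex R k) y = \sum_(b : B) coord y b * u k b.
Proof.
rewrite /mixed_payoff (bigD1 k)//= [X in _ + X]big1 => [|l /negPf lk].
  by rewrite addr0; apply: eq_bigr => b _; rewrite coord_vertex eqxx mul1r.
by rewrite big1// => b _; rewrite coord_vertex lk !mul0r.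
Qed.

Lemma mixed_payoff_mean (x : 'rV[R]_#|A|) y :
  mixed_payoff u x y = \sum_(k : A) coord x k * mixed_payoff u (vertex R k) y.
Proof.
apply: eq_bigr => k _; rewrite mixed_payoff_vertex mulr_sumr.
by apply: eq_bigr => b _; rewrite mulrA.
Qed.

Lemma mixed_payoff_marginal k z :
  mixed_payoff u (vertex R k) (marginal other z) =
  \sum_(a : S) coord z a * u k (other a).
Proof.
rewrite mixed_payoff_vertex [RHS](partition_big other predT)//=.
apply: eq_bigr => b _; rewrite coord_marginal mulr_suml.
by apply: eq_bigr => a /eqP ->.
Qed.

Lemma coord_mean_regret k z : coord (reg z) k =
  mixed_payoff u (vertex R k) (marginal other z) -
  \sum_(a : S) coord z a * u (own a) (other a).
Proof.
rewrite mixed_payoff_marginal -sumrB coord_sum.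
by apply: eq_bigr => a _; rewrite coordZ coord_vect mulrBr.
Qed.

Lemma best_replyP (x : 'rV[R]_#|A|) y k : best_reply u y x -> 0 < coord x k ->
  forall l, mixed_payoff u (vertex R l) y <= mixed_payoff u (vertex R k) y.
Proof.
move=> [[x0 x1] xy] xk; set g := fun l => mixed_payoff u (vertex R l) y.
have sum0 : \sum_(l : A) coord x l * (maxf g - g l) = 0.
  under eq_bigr do rewrite mulrBr.
  by rewrite sumrB -mulr_suml x1 mul1r -mixed_payoff_mean xy subrr.
have : coord x k * (maxf g - g k) = 0.
  have /psumr_eq0P : forall l, true -> 0 <= coord x l * (maxf g - g l).
    by move=> l _; rewrite mulr_ge0// subr_ge0 le_maxf.
  exact.
move/eqP; rewrite mulf_eq0 gt_eqF//= subr_eq0 => /eqP gk l.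
by rewrite -[leRHS]gk; exact: (le_maxf g l).
Qed.

Lemma best_reply_vertex y k :
  (forall l, mixed_payoff u (vertex R l) y <= mixed_payoff u (vertex R k) y) ->
  best_reply u y (vertex R k).
Proof.
move=> kmax; split; first exact: simplex_vertex.
apply/eqP; rewrite eq_le (le_maxf (fun l => mixed_payoff u (vertex R l) y))/=.
exact/(maxf_leP _ _ k).
Qed.

(** Regrets differ from the payoffs against the marginal of the opponent by a
    constant, so an action of maximal regret is a best reply to it. *)
Lemma curb_best_regret (B1 : {set A}) (B2 : {set B}) z k :
  (forall y, face B2 y -> best_reply u y `<=` face B1) -> simplex z ->
  (forall a, other a \notin B2 -> coord z a = 0) ->
  (forall l, coord (reg z) l <= coord (reg z) k) -> k \in B1.
Proof.
move=> cB sz zB kmax; apply/negPn/negP => kB1.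
have yB : face B2 (marginal other z).
  split=> [|b bB2]; first exact: simplex_marginal.
  by rewrite coord_marginal big1// => a /eqP ab; apply: zB; rewrite ab.
have /(cB _ yB)[_ /(_ k kB1)] : best_reply u (marginal other z) (vertex R k).
  apply: best_reply_vertex => l.
  by have := kmax l; rewrite !coord_mean_regret lerD2r.
by rewrite coord_vertex eqxx => /eqP; rewrite oner_eq0.
Qed.

Variables (q : seq S -> 'rV[R]_#|A|) (q' : seq S -> 'rV[R]_#|B|).
Variable P : 'rV[R]_#|A| -> R.
Hypothesis k0 : A.
Hypothesis sq : strategy q.
Hypothesis potP : potential P.
Hypothesis qP : forall h, (0 < size h)%N ->
  let z := empirical R h in
  (0 < maxf (coord (reg z)) -> forall k, coord (q h) k =
     coord (grad P (reg z)) k / \sum_(s : A) coord (grad P (reg z)) s) /\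
  (maxf (coord (reg z)) <= 0 -> best_reply u (marginal other z) (q h)).

(** If some regret is positive, the gradient vanishes on the actions of
    nonpositive regret; otherwise the player uses best replies, which are the
    actions of maximal regret. *)
Lemma regret_action_support h k : (0 < size h)%N -> 0 < coord (q h) k ->
  0 < coord (reg (empirical R h)) k \/
  forall l, coord (reg (empirical R h)) l <= coord (reg (empirical R h)) k.
Proof.
move=> h0 qk; have [q1 q2] := qP h0; set z := empirical R h in q1 q2 *.
have [m0|m0] := leP (maxf (coord (reg z))) 0.
  right=> l; rewrite !coord_mean_regret lerD2r.
  exact: best_replyP (q2 m0) qk l.
left; rewrite ltNge; apply/negP => xk.
have [_ [_ [_ [_ [_ [_ [_ R3]]]]]]] := potP.
have := q1 m0 k; rewrite R3// ?mul0r => [e|nz]; first by rewrite e ltxx in qk.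
by move: m0; rewrite ltNge => /negP; apply; apply/(maxf_leP _ _ k0).
Qed.

Hypothesis prodE : forall F : A -> B -> R,
  \sum_(a : S) F (own a) (other a) = \sum_(k : A) \sum_(b : B) F k b.

(** The play is proportional to the gradient, so that the expected pure regret
    in the direction of the gradient is an antisymmetric double sum. *)
Lemma blackwell_condition h : (0 < size h)%N ->
  \sum_(a : S) coord (q h) (own a) * coord (q' h) (other a) *
     dotp (grad P (reg (empirical R h))) (pure_regret a) = 0.
Proof.
move=> h0; have [q1 _] := qP h0; set z := empirical R h in q1 *.
have [dP [_ [_ [P0 _]]]] := potP.
have [/(maxf_leP _ _ k0) m0|m0] := leP (maxf (coord (reg z))) 0.
  have Pz : P (reg z) = 0 by apply/(potential_eq0 _ potP).
  rewrite big1// => a _; rewrite grad_at_min// => [|y]; last by rewrite Pz.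
  by rewrite /dotp big1 ?mulr0// => k _; rewrite coord0 mul0r.
set p := q h; set G := \sum_(s : A) coord (grad P (reg z)) s.
have [p0 p1] : simplex p by exact: sq.
have gE k : coord (grad P (reg z)) k = G * coord p k.
  rewrite /p q1// -/G mulrC mulfVK//; apply/eqP => G0.
  have := p1; rewrite /p big1 => [/esym/eqP|j _]; first by rewrite oner_eq0.
  by rewrite q1// -/G G0 invr0 mulr0.
move: G gE => G gE.
pose F k (b : B) := coord p k * coord (q' h) b *
  \sum_(j : A) G * coord p j * (u j b - u k b).
transitivity (\sum_(a : S) F (own a) (other a)).
  apply: eq_bigr => a _; congr (_ * _); apply: eq_bigr => j _.
  by rewrite gE /pure_regret coord_vect.
rewrite prodE exchange_big big1//= => b _.
have -> : \sum_(k : A) F k b = coord (q' h) b * G *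
    \sum_(k : A) \sum_(j : A) coord p k * coord p j * (u j b - u k b).
  rewrite mulr_sumr; apply: eq_bigr => k _; rewrite /F !mulr_sumr.
  by apply: eq_bigr => j _; ring.
set X := \sum_(k : A) _.
have XN : X = - X.
  rewrite [LHS]exchange_big /= -sumrN; apply: eq_bigr => k _.
  by rewrite -sumrN; apply: eq_bigr => j _; ring.
by have -> : X = 0 by [lra]; rewrite mulr0.
Qed.

End player.

Section games.
Context {R : realType} {A1 A2 : finType}.

Lemma regret1E (u1 : A1 -> A2 -> R) :
  regret1 u1 = mean_vector (pure_regret fst snd u1).
Proof.
apply/funext => z; apply: coordP => k.
by rewrite coord_mean_regret /regret1 coord_vect.
Qed.

Lemma mixed_payoffC (A B : finType) (u : A -> B -> R) x y :
  mixed_payoff u x y = mixed_payoff (fun b a => u a b) y x.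
Proof.
rewrite /mixed_payoff exchange_big; apply: eq_bigr => l _; apply: eq_bigr => k _.
by rewrite [coord x k * _]mulrC.
Qed.

Lemma regret2E (u2 : A1 -> A2 -> R) :
  regret2 u2 = mean_vector (pure_regret snd fst (fun b a => u2 a b)).
Proof.
apply/funext => z; apply: coordP => k.
by rewrite coord_mean_regret /regret2 coord_vect mixed_payoffC.
Qed.

End games.

(** * Sublevel sets of a Lyapunov function *)

Lemma cvgn0P (R : realType) (f : nat -> R) : f t @[t --> \oo] --> (0 : R) <->
  forall m : nat, exists N : nat, forall t, (N <= t)%N -> `|f t| < m.+1%:R^-1.
Proof.
split=> [/cvgrPdist_lt f0 m|fm].
  have [|N _ NP] := f0 m.+1%:R^-1; first by rewrite invr_gt0.
  by exists N => t Nt; have := NP t Nt; rewrite /= sub0r normrN.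
apply/cvgrPdist_lt => e e0.
have /archi_boundP eB : 0 <= e^-1 by rewrite invr_ge0 ltW.
have [N NP] := fm (Num.bound e^-1).
exists N => // t Nt /=; rewrite sub0r normrN (lt_trans (NP t Nt))//.
rewrite invf_plt ?posrE//; apply: (lt_trans eB).
by rewrite ltr_nat.
Qed.

Lemma exists_pos_forall (R : realType) (T : finType) (Q : T -> R -> Prop) :
  (forall k e e', e' <= e -> Q k e -> Q k e') ->
  (forall k, exists2 e, 0 < e & Q k e) -> exists2 e, 0 < e & forall k, Q k e.
Proof.
move=> Qle Qex.
have /choice[f fP] : forall k, exists e, 0 < e /\ Q k e.
  by move=> k; have [e e0 Qe] := Qex k; exists e.
exists (\big[Num.min/1]_(k : T) f k) => [|k].
  by apply: lt_bigmin => // k _; case: (fP k).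
by apply: (Qle k (f k)); [exact: bigmin_le_cond | case: (fP k)].
Qed.

Lemma continuous_lipschitz1 (R : realType) (V : normedModType R) (f : V -> R) :
  (forall x y, `|f x - f y| <= `|x - y|) -> continuous f.
Proof.
move=> fL x; apply/cvgrPdist_le => e e0; near=> y.
apply: (le_trans (fL x y)).
by near: y; apply: cvgr_dist_le => //; exact: cvg_id.
Unshelve. all: by end_near. Qed.

Section set_dist.
Context {R : realType} {n : nat} (C : set 'rV[R]_n).
Hypothesis C0 : C !=set0.
Implicit Types x y : 'rV[R]_n.

Let has_inf_dist x : has_inf [set `|x - c| | c in C].
Proof.
split; first by case: C0 => c Cc; exists `|x - c|, c.
by exists 0 => _ [c _ <-].
Qed.

Lemma set_dist_ge0 x : 0 <= set_dist C x.
Proof.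
by apply: lb_le_inf; [exact: (has_inf_dist x).1 | move=> _ [c _ <-]].
Qed.

Lemma set_dist_le x y : set_dist C x <= `|x - y| + set_dist C y.
Proof.
rewrite -lerBlDl; apply: lb_le_inf; first exact: (has_inf_dist y).1.
move=> _ [c Cc <-]; rewrite lerBlDl (le_trans _ (ler_distD y x c))//.
by apply: ge_inf; [exact: (has_inf_dist x).2 | exists c].
Qed.

Lemma continuous_set_dist : continuous (set_dist C).
Proof.
apply: continuous_lipschitz1 => x y; rewrite ler_distl.
have h1 := set_dist_le x y; have h2 := set_dist_le y x.
by rewrite distrC in h2; apply/andP; split; lra.
Qed.

End set_dist.

(** L is small near its sublevel set C by uniform continuity.  Conversely, points
    where L is small are near C, because L has a positive minimum on any closed
    part of K that misses C. *)
Section lyapunov.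
Context {R : realType} {n : nat} (K : set 'rV[R]_n) (L : 'rV[R]_n -> R).
Hypothesis cK : compact K.
Hypothesis cL : continuous L.

Let C := [set z | K z /\ L z <= 0].

Lemma lyapunov_gap (D : set 'rV[R]_n) : closed D ->
  (forall z, K z -> D z -> 0 < L z) ->
  exists2 e : R, 0 < e & forall z, K z -> D z -> e <= L z.
Proof.
move=> cD DL.
have [z [Kz Dz]|e e0 eP] := compact_pos_lbound (compact_closedI cK cD) cL.
  exact: DL.
by exists e => // z Kz Dz; apply: eP.
Qed.

Lemma lyapunov_near (e : R) : 0 < e -> exists2 e' : R, 0 < e' &
  forall z c, K z -> C c -> `|z - c| < e' -> L z < e.
Proof.
move=> e0; have [e' e'0 e'P] := compact_uniform_continuous cK (cL : continuous (L : _ -> R^o)) e0.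
exists e' => // z c Kz [Kc Lc] zc.
have := le_lt_trans (ler_norm _) (e'P z c Kz Kc zc); lra.
Qed.

Lemma lyapunov_cvg (z : nat -> 'rV[R]_n) : C !=set0 ->
  (forall t, (0 < t)%N -> K (z t)) ->
  (forall e : R, 0 < e -> exists N : nat, forall t, (N <= t)%N -> L (z t) < e) ->
  set_dist C (z t) @[t --> \oo] --> (0 : R).
Proof.
move=> C0 Kz Lz; apply/cvgn0P => m.
have cD : closed [set x | m.+1%:R^-1 <= set_dist C x].
  exact: continuous_closed_le (continuous_set_dist C0).
have m0 : 0 < m.+1%:R^-1 :> R by rewrite invr_gt0.
have [x Kx /= mx|e e0 eP] := lyapunov_gap cD.
  rewrite ltNge; apply/negP => Lx; move: mx; rewrite leNgt => /negP; apply.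
  rewrite (le_lt_trans _ m0)// (le_trans (set_dist_le C0 x x))//.
  rewrite subrr normr0 add0r; apply: ge_inf; first by exists 0 => _ [c _ <-].
  by exists x; rewrite ?subrr ?normr0.
have [N NP] := Lz e e0; exists N.+1 => t Nt.
rewrite ger0_norm ?set_dist_ge0// ltNge; apply/negP => mt.
have := eP (z t) (Kz _ (leq_ltn_trans (leq0n _) Nt)) mt.
by rewrite leNgt NP// ltnW.
Qed.

End lyapunov.

(** * Actions near the Hannan set of a curb set *)

(** The distributions at which the player may choose k form a closed set.  If k
    is outside B1, this set misses the sublevel set of L: there all regrets are
    nonpositive, so k would have maximal regret and be a best reply to a mixed
    action supported in B2.  Hence L has a positive lower bound on it. *)
Lemma curb_gap (R : realType) (S A B : finType) (own : S -> A) (other : S -> B)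
    (u : A -> B -> R) (B1 : {set A}) (B2 : {set B}) (L : 'rV[R]_#|S| -> R) :
  (forall y, face B2 y -> best_reply u y `<=` face B1) -> continuous L ->
  (forall z, simplex z -> L z <= 0 ->
     (forall a, other a \notin B2 -> coord z a = 0) /\
     forall k, coord (mean_vector (pure_regret own other u) z) k <= 0) ->
  exists2 e : R, 0 < e & forall z, simplex z -> L z < e -> forall k,
    0 < coord (mean_vector (pure_regret own other u) z) k \/
    (forall l, coord (mean_vector (pure_regret own other u) z) l <=
       coord (mean_vector (pure_regret own other u) z) k) ->
    k \in B1.
Proof.
move=> cB cL L0; set reg := mean_vector _.
pose D k := [set z | 0 <= coord (reg z) k] `|`
  \bigcap_(l in [set: A]) [set z | coord (reg z) l <= coord (reg z) k].
have creg k : continuous (fun z => coord (reg z) k).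
  have ck := @continuous_coord R A k.
  have cm := @continuous_mean_vector R S A (pure_regret own other u).
  have ckm := continuous_compose cm ck.
  exact ckm.
have cD k : closed (D k).
  apply: closedU; first exact: continuous_closed_le (creg k).
  by apply: closed_bigI => l _; apply: continuous_closed_le2; exact: creg.
have [e e0 eP] : exists2 e : R, 0 < e &
    forall k, k \notin B1 -> forall z, simplex z -> D k z -> e <= L z.
  apply: (@exists_pos_forall _ _ (fun k e => k \notin B1 ->
    forall z, simplex z -> D k z -> e <= L z)) => [k e e' ee' + kB z sz Dz|k].
    by move=> /(_ kB z sz Dz); exact: le_trans.
  have [kB|kB] := boolP (k \in B1); first by exists 1.
  have [z sz Dz|e e0 eP] := lyapunov_gap (@compact_simplex R S) cL (cD k); last by exists e.
  rewrite ltNge; apply/negP => /(L0 z sz)[zB z0].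
  have : k \in B1; last by rewrite (negPf kB).
  apply: (curb_best_regret cB sz zB) => l.
  by case: Dz => [zk|/(_ l Logic.I)]; [exact: le_trans (z0 l) zk | exact].
exists e => // z sz Lz k kP; apply/negPn/negP => kB.
move: Lz; rewrite ltNge (eP k kB z sz)//.
by case: kP => [/ltW|kmax]; [left | right=> l _; exact: kmax].
Qed.

(** * Mass outside a set of action profiles *)

Section mass_outside.
Context {R : realType} {S : finType} (B : {set S}).
Implicit Types (z : 'rV[R]_#|S|) (h : seq S).

Definition mass_outside z : R := \sum_(a | a \notin B) coord z a.

Lemma mass_outside_ge0 z : simplex z -> 0 <= mass_outside z.
Proof. by move=> [z0 _]; apply: sumr_ge0 => a _. Qed.

Lemma continuous_mass_outside : continuous mass_outside.
Proof.
have -> : mass_outside = fun z => \sum_(a : S) (if a \notin B then coord z a else 0).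
  by apply/funext => z; rewrite /mass_outside big_mkcond.
apply: continuous_sum_fin => a; case: (a \notin B).
  exact: continuous_coord.
exact: cst_continuous.
Qed.

Lemma mass_outside_rcons h a : a \in B ->
  (size h).+1%:R * mass_outside (empirical R (rcons h a)) =
  (size h)%:R * mass_outside (empirical R h).
Proof.
move=> aB; rewrite !mulr_sumr; apply: eq_bigr => b bB.
rewrite -!coordZ empirical_rcons coordD coord_vertex.
by case: eqP => [ba|_]; rewrite ?addr0//; rewrite ba aB in bB.
Qed.

Variables (act : nat -> S) (t0 : nat) (e : R).
Let z t := empirical R [seq act s | s <- iota 1 t].
Hypothesis t00 : (0 < t0)%N.
Hypothesis actB : forall t, (t0 <= t)%N -> mass_outside (z t) < e -> act t.+1 \in B.
Hypothesis zt0 : mass_outside (z t0) < e.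

(** An action in B leaves t times the mass outside B unchanged, so the mass
    decreases and the condition under which the actions stay in B persists. *)
Lemma mass_outside_path t : (t0 <= t)%N ->
  mass_outside (z t) < e /\
  t%:R * mass_outside (z t) = t0%:R * mass_outside (z t0).
Proof.
elim: t => [|t IH]; first by rewrite leqNgt t00.
rewrite leq_eqVlt => /predU1P[<- //|tt].
have [zt mt] := IH tt.
have m0 : 0 <= mass_outside (z t0).
  apply/mass_outside_ge0/simplex_empirical.
  by rewrite size_map size_iota.
have mS : t.+1%:R * mass_outside (z t.+1) = t0%:R * mass_outside (z t0).
  rewrite -mt; have := mass_outside_rcons [seq act s | s <- iota 1 t] (actB tt zt).
  rewrite size_map size_iota -map_rcons => <-; congr (_ * _).
  by rewrite /z -{1}(addn1 t) iotaD add1n cats1.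
split=> //; apply: le_lt_trans zt0.
rewrite -(@ler_pM2l _ t.+1%:R) ?ltr0n// mS ler_wpM2r// ler_nat.
exact: ltnW.
Qed.

Lemma mass_outside_cvg (e' : R) : 0 < e' ->
  exists N : nat, forall t, (N <= t)%N -> mass_outside (z t) < e'.
Proof.
move=> e'0; set c := t0%:R * mass_outside (z t0).
have c0 : 0 <= c.
  rewrite mulr_ge0//; apply/mass_outside_ge0/simplex_empirical.
  by rewrite size_map size_iota.
have /archi_boundP cB : 0 <= c / e' by rewrite divr_ge0// ltW.
exists (maxn t0 (Num.bound (c / e'))) => t; rewrite geq_max => /andP[tt ct].
have [_ mt] := mass_outside_path tt.
have t1 : 0 < t%:R :> R by rewrite ltr0n (leq_trans t00).
rewrite -(@ltr_pM2l _ t%:R)// mt -/c -ltr_pdivrMr//.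
by apply: (lt_le_trans cB); rewrite ler_nat.
Qed.

End mass_outside.

(** * Attraction *)

Lemma measurable_history_cvg0 (R : realType) (S : finType)
    (d : measure_display) (Omega : measurableType d) (act : nat -> Omega -> S)
    (f : seq S -> R) :
  (forall t a, measurable [set w | act t.+1 w = a]) ->
  measurable [set w | f (history act t w) @[t --> \oo] --> (0 : R)].
Proof.
move=> mact; rewrite (_ : [set w | _] = \bigcap_m \bigcup_N
  \bigcap_(t in [set t | (N <= t)%N])
    [set w | `|f (history act t w)| < m.+1%:R^-1]).
  apply: bigcapT_measurable => m; apply: bigcupT_measurable => N.
  apply: bigcap_measurable => [|t _]; first by exists N; exact: leqnn.
  exact: (measurable_history mact t (fun h => `|f h| < m.+1%:R^-1)).
apply/seteqP; split=> w /=.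
  move=> /cvgn0P fw m _; have [N NP] := fw m.
  by exists N => // t; exact: NP.
move=> fw; apply/cvgn0P => m; have [N _ NP] := fw m Logic.I.
by exists N => t; exact: NP.
Qed.

Lemma cond_prob_ge (R : realType) (d : measure_display)
    (Omega : measurableType d) (P : probability Omega R)
    (E H U1 U2 N : set Omega) (p : R) :
  measurable E -> measurable H -> measurable U1 -> measurable U2 ->
  P.-negligible N -> H `<=` E `|` U1 `|` U2 `|` N -> (0 < P H)%E ->
  (P (H `&` U1) <= P H * (p / 2)%:E)%E -> (P (H `&` U2) <= P H * (p / 2)%:E)%E ->
  1 - p <= cond_prob P E H.
Proof.
move=> mE mH mU1 mU2 [M [mM M0 NM]] HE H0 HU1 HU2.
have fP A : measurable A -> P A = (fine (P A))%:E.
  by move=> mA; rewrite fineK// fin_num_measure.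
have : (P H <= P (E `&` H) + P (H `&` U1) + P (H `&` U2))%E.
  have -> : (P (E `&` H) + P (H `&` U1) + P (H `&` U2) =
      P (E `&` H) + P (H `&` U1) + P (H `&` U2) + P M)%E by rewrite M0 adde0.
  apply: (@le_trans _ _ (P (E `&` H `|` H `&` U1 `|` H `&` U2 `|` M))).
    apply: le_measure; rewrite ?inE//.
      by do !apply: measurableU => //; apply: measurableI.
    move=> w Hw; have [[[Ew|Uw]|Uw]|/NM Mw] := HE w Hw.
    - by do 3 left.
    - by left; left; right.
    - by left; right.
    - by right.
  apply: (le_trans (measureU2 _ _ _)) => //.
    by do !apply: measurableU => //; apply: measurableI.
  rewrite leeD2r//; apply: (le_trans (measureU2 _ _ _)).
  - by do !apply: measurableU => //; apply: measurableI.
  - exact: measurableI.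
  - by rewrite leeD2r//; apply: measureU2; apply: measurableI.
move: HU1 HU2 H0; rewrite /cond_prob.
rewrite (fP _ mH) (fP _ (measurableI _ _ mE mH)) (fP _ (measurableI _ _ mH mU1)).
rewrite (fP _ (measurableI _ _ mH mU2)) -EFinM -!EFinD !lee_fin lte_fin /=.
move=> HU1 HU2 H0 HE'; rewrite ler_pdivlMr//; lra.
Qed.

Lemma geometric_tail_small (R : realType) (rho c : R) : 0 < rho < 1 -> 0 < c ->
  exists N : nat, forall t, (N <= t)%N -> rho ^+ t / (1 - rho) <= c.
Proof.
move=> /andP[r0 r1] c0.
have /cvgrPdist_lt : rho ^+ t @[t --> \oo] --> (0 : R).
  by apply: cvg_expr; rewrite ger0_norm// ltW.
move=> /(_ (c * (1 - rho))) []; first by rewrite mulr_gt0// subr_gt0.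
move=> N _ NP; exists N => t Nt.
rewrite ler_pdivrMr ?subr_gt0//.
have := NP t Nt; rewrite /= sub0r normrN ger0_norm; first exact: ltW.
by rewrite exprn_ge0// ltW.
Qed.

Section potential_along_play.
Context {R : realType} {S A : finType} {d : measure_display}.
Context {Omega : measurableType d}.
Variables (Pr : probability Omega R) (act : nat -> Omega -> S).
Variables (r : S -> 'rV[R]_#|A|) (P : 'rV[R]_#|A| -> R) (Q : seq S -> S -> R).
Let V h := P (mean_vector r (empirical R h)).

Hypothesis mact : forall t a, measurable [set w | act t.+1 w = a].
Hypothesis Q0 : forall h a, 0 <= Q h a.
Hypothesis Q1 : forall h, \sum_(a : S) Q h a = 1.
Hypothesis law : forall h a, (0 < Pr [set w | history act (size h) w = h])%E ->
  Pr ([set w | act (size h).+1 w = a] `&` [set w | history act (size h) w = h])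
  = (Pr [set w | history act (size h) w = h] * (Q h a)%:E)%E.
Hypothesis potP : potential P.
Hypothesis QP : forall h, (0 < size h)%N -> \sum_(a : S) Q h a *
  dotp (grad P (mean_vector r (empirical R h))) (r a) = 0.

Lemma potential_stays_small (eta c : R) : 0 < eta -> 0 < c ->
  exists T : nat, forall h, (T < size h)%N -> V h <= eta / 2 ->
  (Pr ([set w | history act (size h) w = h] `&`
     \bigcup_n [set w | (eta <= V (history act (size h + n) w))%R]) <=
   Pr [set w | history act (size h) w = h] * c%:E)%E.
Proof.
move=> eta0 c0; have [rho r01 [T TP]] := potential_concentration potP Q0 Q1 QP eta0.
have [T' T'P] := geometric_tail_small r01 c0.
exists (maxn T T') => h; rewrite gtn_max => /andP[Th T'h] Vh.
have [_ /(_ Vh) hP] := TP h Th.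
apply: (le_trans (prob_eventually_bad mact Q0 law (D := fun h => eta <= V h) r01 hP)).
by rewrite lee_wpmul2l// lee_fin T'P// ltnW.
Qed.

(** If V does not tend to 0 along a path, it exceeds some 1/(m + 1) infinitely
    often, which is negligible for each m. *)
Lemma potential_vanishes : Pr.-negligible [set w | ~ forall e : R, 0 < e ->
  exists N : nat, forall t, (N <= t)%N -> V (history act t w) < e].
Proof.
apply: (@negligibleS _ _ _ _ [set w | exists m : nat, forall N : nat,
    exists2 t, (N <= t)%N & m.+1%:R^-1 <= V (history act t w)]).
  move=> w nV; apply: contrapT => nio; apply: nV => e e0.
  have /archi_boundP eB : 0 <= e^-1 by rewrite invr_ge0 ltW.
  apply: contrapT => nN; apply: nio; exists (Num.bound e^-1) => N.
  apply: contrapT => nt; apply: nN; exists N => t Nt.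
  apply: (@lt_trans _ _ (Num.bound e^-1).+1%:R^-1).
    by rewrite ltNge; apply/negP => Vt; apply: nt; exists t.
  rewrite invf_plt ?posrE//; apply: (lt_trans eB).
  by rewrite ltr_nat.
apply: (@negligible_exists _ _ _ _ nat (fun m => [set w | forall N : nat,
    exists2 t, (N <= t)%N & m.+1%:R^-1 <= V (history act t w)])) => m.
have [|rho r01 [T TP]] := potential_concentration potP Q0 Q1 QP (eta := m.+1%:R^-1).
  by rewrite invr_gt0.
apply: (negligible_infinitely_often mact Q0 law (D := fun h => m.+1%:R^-1 <= V h) (T := T) r01).
by move=> h Th; have [] := TP h Th.
Qed.

End potential_along_play.

Lemma play_law (R : realType) (A1 A2 : finType) (d : measure_display)
    (Omega : measurableType d) (P : probability Omega R)
    (q1 : seq (A1 * A2) -> 'rV[R]_#|A1|) (q2 : seq (A1 * A2) -> 'rV[R]_#|A2|)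
    (act : nat -> Omega -> A1 * A2) h a : play P q1 q2 act ->
  (0 < P [set w | history act (size h) w = h])%E ->
  P ([set w | act (size h).+1 w = a] `&` [set w | history act (size h) w = h])
  = (P [set w | history act (size h) w = h] *
     (coord (q1 h) a.1 * coord (q2 h) a.2)%:E)%E.
Proof.
move=> [mact law] H0; have := law _ _ H0 a.1 a.2; rewrite -surjective_pairing.
have mH := measurable_history mact (size h) (fun g => g = h).
have fP B : measurable B -> P B = (fine (P B))%:E.
  by move=> mB; rewrite fineK// fin_num_measure.
rewrite /cond_prob fP; last exact: measurableI.
move: H0; rewrite (fP _ mH) lte_fin /= => H0 <-.
by rewrite -EFinM mulrCA mulfV ?mulr1// gt_eqF.
Qed.

Theorem proposition3 (R : realType) (A1 A2 : finType)
    (u1 u2 : A1 -> A2 -> R) (B1 : {set A1}) (B2 : {set A2})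
    (hB : curb u1 u2 B1 B2)
    (d : measure_display) (Omega : measurableType d)
    (P : probability Omega R) (act : nat -> Omega -> A1 * A2)
    (hact : class_R u1 u2 P act) :
  eventually_attracting P act (hannan_in u1 u2 B1 B2).
Proof.
have [/set0Pn[k1 k1B] /set0Pn[k2 k2B] cB1 cB2] := hB.
have [q1 [q2 [sq1 sq2 [P1 pot1 c1] [P2 pot2 c2] hplay]]] := hact.
have mact := hplay.1; have law h a := play_law (h := h) a hplay.
set C := hannan_in _ _ _ _.
have [C0|nC] := pselect (C !=set0); last first.
  (* No history is close to the empty set. *)
  by move=> p p0; exists 1 => //; exists 0%N => t0 _ h _ [c Cc _]; exfalso; apply: nC; exists c.
rewrite regret1E in c1; rewrite regret2E in c2.
pose r1 := pure_regret fst snd u1.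
pose r2 := pure_regret snd fst (fun b a => u2 a b).
pose V1 z := P1 (mean_vector r1 z); pose V2 z := P2 (mean_vector r2 z).
pose B := finset.setX B1 B2.
pose L z := mass_outside B z + V1 z + V2 z.
pose Q (h : seq (A1 * A2)) (a : A1 * A2) := coord (q1 h) a.1 * coord (q2 h) a.2.
have Q0 h a : 0 <= Q h a.
  by rewrite mulr_ge0//; [case: (sq1 h) | case: (sq2 h)].
have prod1 (F : A1 -> A2 -> R) :
    \sum_(a : A1 * A2) F a.1 a.2 = \sum_(k : A1) \sum_(l : A2) F k l.
  by rewrite pair_big.
have prod2 (F : A2 -> A1 -> R) :
    \sum_(a : A1 * A2) F a.2 a.1 = \sum_(l : A2) \sum_(k : A1) F l k.
  by rewrite exchange_big (prod1 (fun k l => F l k)).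
have Q1 h : \sum_a Q h a = 1.
  rewrite (prod1 (fun k l => coord (q1 h) k * coord (q2 h) l)).
  have [[_ q11] [_ q21]] := (sq1 h, sq2 h).
  by rewrite -q11; apply: eq_bigr => k _; rewrite -mulr_sumr q21 mulr1.
have QP1 h := blackwell_condition q2 k1 sq1 pot1 c1 prod1 (h := h).
have QP2 h : (0 < size h)%N -> \sum_a Q h a *
    dotp (grad P2 (mean_vector r2 (empirical R h))) (r2 a) = 0.
  move=> h0; rewrite -[RHS](blackwell_condition q1 k2 sq2 pot2 c2 prod2 h0).
  by apply: eq_bigr => a _; rewrite /Q [coord (q1 h) _ * _]mulrC.
have V10 z : 0 <= V1 z by have [_ [_ [_ [P0 _]]]] := pot1; exact: P0.
have V20 z : 0 <= V2 z by have [_ [_ [_ [P0 _]]]] := pot2; exact: P0.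
have cL : continuous L.
  have cV1 : continuous V1.
    apply: continuous_compose (potential_continuous pot1).
    exact: continuous_mean_vector.
  have cV2 : continuous V2.
    apply: continuous_compose (potential_continuous pot2).
    exact: continuous_mean_vector.
  have cm := continuousD_fun (@continuous_mass_outside R _ B) cV1.
  have cmV := continuousD_fun cm cV2.
  exact cmV.
have L0 z : simplex z -> L z <= 0 -> [/\ forall a, a \notin B -> coord z a = 0,
    forall k, coord (mean_vector r1 z) k <= 0
    & forall k, coord (mean_vector r2 z) k <= 0].
  move=> sz Lz; have m0 := mass_outside_ge0 B sz.
  have [v1 v2] := (V10 z, V20 z); rewrite /L in Lz; split.
  - have : mass_outside B z = 0 by lra.
    move=> /psumr_eq0P mz a aB; apply: mz => // b _; by case: sz.
  - by apply/(potential_eq0 _ pot1); rewrite -/(V1 z); lra.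
  - by apply/(potential_eq0 _ pot2); rewrite -/(V2 z); lra.
have CE : C = [set z | simplex z /\ L z <= 0].
  apply/seteqP; split=> z.
    move=> [[sz z1 z2] [_ zB]]; split=> //.
    rewrite regret1E in z1; rewrite regret2E in z2.
    rewrite /L (_ : mass_outside B z = 0) ?add0r; last by rewrite /mass_outside big1.
    have -> : V1 z = 0 by apply/(potential_eq0 _ pot1)/(maxf_leP _ _ k1).
    have -> : V2 z = 0 by apply/(potential_eq0 _ pot2)/(maxf_leP _ _ k2).
    by rewrite add0r.
  move=> [sz /(L0 z sz)[zB z1 z2]]; split; last by [].
  split=> //; first by rewrite regret1E; apply/(maxf_leP _ _ k1).
  by rewrite regret2E; apply/(maxf_leP _ _ k2).
have [e1 e10 gap1] : exists2 e : R, 0 < e & forall z, simplex z -> L z < e ->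
    forall k, 0 < coord (mean_vector r1 z) k \/ (forall l,
      coord (mean_vector r1 z) l <= coord (mean_vector r1 z) k) -> k \in B1.
  apply: (curb_gap cB1 cL) => z sz /(L0 z sz)[zB z1 _]; split=> // -[a1 a2] aB.
  by apply: zB; rewrite finset.in_setX negb_and aB orbT.
have [e2 e20 gap2] : exists2 e : R, 0 < e & forall z, simplex z -> L z < e ->
    forall k, 0 < coord (mean_vector r2 z) k \/ (forall l,
      coord (mean_vector r2 z) l <= coord (mean_vector r2 z) k) -> k \in B2.
  apply: (curb_gap cB2 cL) => z sz /(L0 z sz)[zB _ z2]; split=> // -[a1 a2] aB.
  by apply: zB; rewrite finset.in_setX negb_and aB.
(* A third of the threshold for each of the three terms of L. *)
pose eta := Num.min e1 e2 / 3.
have eta0 : 0 < eta by rewrite divr_gt0// lt_min e10 e20.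
have eta1 : eta * 3 <= e1 by rewrite mulfVK// ge_min lexx.
have eta2 : eta * 3 <= e2 by rewrite mulfVK// ge_min lexx orbT.
move=> p p0; have p20 : 0 < p / 2 by rewrite divr_gt0.
have [T1 T1P] := potential_stays_small mact Q0 Q1 law pot1 QP1 eta0 p20.
have [T2 T2P] := potential_stays_small mact Q0 Q1 law pot2 QP2 eta0 p20.
have eta20 : 0 < eta / 2 by rewrite divr_gt0.
have [eps eps0 epsP] := lyapunov_near (@compact_simplex R _) cL eta20.
exists eps => //; exists (maxn T1 T2).+1 => t0 Tt0 h Ph [c Cc hc].
have ht0 : t0 = size h.
  apply: contrapT => neq; move: Ph; rewrite (_ : [set _ | _] = set0) ?measure0 ?ltxx//.
  by apply/seteqP; split=> w //= hw; apply: neq; rewrite -hw size_history.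
subst t0; move: Tt0; rewrite gtn_max => /andP[hT1 hT2].
have h0 : (0 < size h)%N by exact: leq_ltn_trans hT1.
have sh := simplex_empirical (R := R) h0.
have Lh : L (empirical R h) < eta / 2.
  by apply: epsP hc => //; rewrite CE in Cc.
have mh := mass_outside_ge0 B sh.
have V1h : V1 (empirical R h) <= eta / 2 by have := V20 (empirical R h); rewrite /L in Lh; lra.
have V2h : V2 (empirical R h) <= eta / 2 by have := V10 (empirical R h); rewrite /L in Lh; lra.
have mhe : mass_outside B (empirical R h) < eta.
  by have := V10 (empirical R h); have := V20 (empirical R h); rewrite /L in Lh; lra.
pose U1 := \bigcup_n [set w | eta <= V1 (empirical R (history act (size h + n) w))].
pose U2 := \bigcup_n [set w | eta <= V2 (empirical R (history act (size h + n) w))].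
have mU (f : seq (A1 * A2) -> R) : measurable
    (\bigcup_n [set w | eta <= f (history act (size h + n) w)]).
  apply: bigcupT_measurable => n.
  exact: (measurable_history mact (size h + n) (fun g => eta <= f g)).
(* Outside U1 and U2, the potentials stay below eta after h; outside the
   negligible set, they tend to 0 and every action had positive probability. *)
have N0 := negligibleU (negligible_null_history P mact)
  (negligibleU (potential_vanishes mact Q0 Q1 law pot1 QP1)
               (potential_vanishes mact Q0 Q1 law pot2 QP2)).
apply: (cond_prob_ge _ _ (mU (fun g => V1 (empirical R g)))
  (mU (fun g => V2 (empirical R g))) N0 _ Ph (T1P h hT1 V1h) (T2P h hT2 V2h)).
- exact: (measurable_history_cvg0 (fun g => set_dist C (empirical R g)) mact).
- exact: (measurable_history mact (size h) (fun g => g = h)).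
move=> w hw.
apply: contrapT => nE; apply: (nE); left; left; left => /=.
have nu1 : ~ U1 w by move=> u1w; apply: nE; left; left; right.
have nu2 : ~ U2 w by move=> u2w; apply: nE; left; right.
pose g t := history act t w.
have sg t : size (g t) = t by exact: size_history.
have pos t : (0 < P [set v | history act (size (g t)) v = g t])%E.
  by apply: contrapT => /negP nt; apply: nE; right; left; exists t.
have v1 : forall e : R, 0 < e -> exists N : nat, forall t, (N <= t)%N ->
    V1 (empirical R (g t)) < e.
  by apply: contrapT => nv; apply: nE; right; right; left.
have v2 : forall e : R, 0 < e -> exists N : nat, forall t, (N <= t)%N ->
    V2 (empirical R (g t)) < e.
  by apply: contrapT => nv; apply: nE; right; right; right.
have sz t : (0 < t)%N -> simplex (empirical R (g t)).
  by move=> t_gt0; apply: simplex_empirical; rewrite sg.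
have actB t : (size h <= t)%N -> mass_outside B (empirical R (g t)) < eta ->
    act t.+1 w \in B.
  move=> ht mt; have t_gt0 : (0 < t)%N by exact: leq_trans ht.
  have V1t : V1 (empirical R (g t)) < eta.
    rewrite ltNge; apply/negP => Vt; apply: nu1; exists (t - size h)%N => //.
    by rewrite /mkset subnKC.
  have V2t : V2 (empirical R (g t)) < eta.
    rewrite ltNge; apply/negP => Vt; apply: nu2; exists (t - size h)%N => //.
    by rewrite /mkset subnKC.
  have := pos t.+1; rewrite /g historyS (prob_rcons mact law) -/(g t) => Qpos.
  have [Q1pos Q2pos] : 0 < coord (q1 (g t)) (act t.+1 w).1 /\
      0 < coord (q2 (g t)) (act t.+1 w).2.
    have c1pos : 0 <= coord (q1 (g t)) (act t.+1 w).1 by case: (sq1 (g t)).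
    have c2pos : 0 <= coord (q2 (g t)) (act t.+1 w).2 by case: (sq2 (g t)).
    rewrite !lt_def c1pos c2pos !andbT; apply/andP; rewrite -negb_or -mulf_eq0.
    by apply/eqP => Q00; move: Qpos; rewrite /Q Q00 mule0 ltxx.
  have gt_gt0 : (0 < size (g t))%N by rewrite sg.
  rewrite [act _ _]surjective_pairing finset.in_setX; apply/andP; split.
    apply: (gap1 (empirical R (g t)) (sz t t_gt0)).
      by rewrite /L; lra.
    exact: (regret_action_support k1 pot1 c1 gt_gt0 Q1pos).
  apply: (gap2 (empirical R (g t)) (sz t t_gt0)).
    by rewrite /L; lra.
  exact: (regret_action_support k2 pot2 c2 gt_gt0 Q2pos).
rewrite CE; apply: (@lyapunov_cvg _ _ _ _ (@compact_simplex R _) cL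
  (fun t => empirical R (g t))) => //.
  by rewrite -CE.
move=> e e0; have e30 : 0 < e / 3 by rewrite divr_gt0.
have mh' : mass_outside B (empirical R (g (size h))) < eta by rewrite /g hw.
have [Nm NmP] := mass_outside_cvg (act := fun s => act s w) h0 actB mh' e30.
have [[Nv1 Nv1P] [Nv2 Nv2P]] := (v1 _ e30, v2 _ e30).
exists (maxn Nm (maxn Nv1 Nv2)) => t; rewrite !geq_max => /andP[tm /andP[t1 t2]].
have := NmP t tm; have := Nv1P t t1; have := Nv2P t t2.
by rewrite /L -/(history act t w) -/(g t); lra.
Qed.
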